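(* Let $q\in(0,1)$, let $j_1,j_2\in\{0,\tfrac12,1,\tfrac32,\dots\}$, $j\in\{|j_1-j_2|,|j_1-j_2|+1,\dots,j_1+j_2\}$, $m_i\in\{-j_i,-j_i+1,\dots,j_i\}$ for $i=1,2$, and assume $m:=m_1+m_2$ satisfies $-j\le m\le j$. Then the Clebsch-Gordan coefficient of $su_q(2)$ is $$\langle j_1m_1,j_2m_2|jm\rangle_q=(-1)^{j_1+j_2-j}\,\Gamma^{j_1,j_2,j}_{m_1,m_2,m}\;{}_3F_2\left(\begin{array}{c} j-j_1-j_2,\; m_2-j_2,\; -j-j_1-j_2-1\\ m-j_1-j_2,\; -2j_2\end{array}\bigg|\,q,\,q^{j_1+m_1}\right),$$ where $$\Gamma^{j_1,j_2,j}_{m_1,m_2,m}=\frac{q^{j_1m_2-j_2m_1-\frac12(j_1+j_2-j)(j_1+j_2+j+1)}\,[2j_2]_q!\,[j_1+j_2-m]_q!\,\sqrt{[2j+1]_q\,[j+m]_q!\,[j+j_1-j_2]_q!}}{\sqrt{[j_1+j_2+j+1]_q!\,[j+j_2-j_1]_q!\,[j_1+j_2-j]_q!\,[j_1+m_1]_q!\,[j_1-m_1]_q!\,[j_2+m_2]_q!\,[j_2-m_2]_q!\,[j-m]_q!}}.$$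
   Context: Notation. For real $q>0$, $q\ne1$: $[x]_q=\frac{q^x-q^{-x}}{q-q^{-1}}$ for $x\in\mathbb R$; $[0]_q!=1$ and $[n]_q!=[1]_q[2]_q\cdots[n]_q$ for $n\in\mathbb N$; $(a|q)_0=1$, $(a|q)_k=\prod_{i=0}^{k-1}[a+i]_q$. The symmetric $q$-hypergeometric function is $${}_3F_2\left(\begin{array}{c}a_1,a_2,a_3\\ b_1,b_2\end{array}\bigg|\,q,z\right)=\sum_{k\ge0}\frac{(a_1|q)_k(a_2|q)_k(a_3|q)_k}{(b_1|q)_k(b_2|q)_k}\frac{z^k}{[k]_q!}.$$ It is always used in terminating form: if one or more of the $a_i$ are non-positive integers, the sum is over $0\le k\le K$, with $K$ the smallest of the values $-a_i$ over those $a_i$ that are non-positive integers (all later terms are taken to vanish). Representations. For $j\in\{0,\frac12,1,\dots\}$, $D^j$ is the complex inner product space with orthonormal basis $|jm\rangle$, $m=-j,-j+1,\dots,j$, and operators $$J_0|jm\rangle=m|jm\rangle,\quad J_-|jm\rangle=\sqrt{[j+m]_q[j-m+1]_q}\,|j\,m-1\rangle,\quad J_+|jm\rangle=\sqrt{[j-m]_q[j+m+1]_q}\,|j\,m+1\rangle,$$ and $q^{aJ_0}|jm\rangle=q^{am}|jm\rangle$. On $D^{j_1}\otimes D^{j_2}$ (orthonormal basis $|j_1m_1\rangle|j_2m_2\rangle$) put $J_0(12)=J_0\otimes1+1\otimes J_0$ and $J_\pm(12)=J_\pm\otimes q^{J_0}+q^{-J_0}\otimes J_\pm$. Clebsch-Gordan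 coefficients. For $j\in\{|j_1-j_2|,\dots,j_1+j_2\}$ and $m\in\{-j,\dots,j\}$ let $$P^j_{mj}=\sqrt{\frac{[j+m]_q!}{[2j]_q!\,[j-m]_q!}}\sum_{r\ge0}\frac{(-1)^r[2j+1]_q!}{[r]_q!\,[2j+r+1]_q!}\,J_-(12)^{\,r+j-m}J_+(12)^{\,r}$$ (a finite sum, since $J_+(12)$ is nilpotent), and let $|j_1,j_2:jm\rangle$ be the unit vector $P^j_{mj}|j_1j_1\rangle|j_2\,j-j_1\rangle/\|P^j_{mj}|j_1j_1\rangle|j_2\,j-j_1\rangle\|$. For $m=m_1+m_2$, $\langle j_1m_1,j_2m_2|jm\rangle_q$ denotes the coefficient of $|j_1m_1\rangle|j_2m_2\rangle$ in $|j_1,j_2:jm\rangle$. *)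

(* Defs.v *)
From mathcomp Require Import all_boot all_order all_algebra.
From mathcomp Require Import all_classical all_reals all_analysis.
From mathcomp Require Import complex mxtens.

Set Implicit Arguments.
Unset Strict Implicit.
Unset Printing Implicit Defensive.

Import Order.TTheory GRing.Theory Num.Theory.
Import numFieldNormedType.Exports.

Local Open Scope ring_scope.
Local Open Scope complex_scope.

Definition qnum (R : realType) (q x : R) : R :=
  (q `^ x - q `^ (- x)) / (q - q^-1).

Definition qfact (R : realType) (q : R) (n : nat) : R :=
  \prod_(1 <= i < n.+1) qnum q i%:R.

(* The arguments of the q-factorials in the Clebsch-Gordan formulas are
   combinations of half-integers that are natural numbers; [Num.truncn] is the
   identity on those. *)
Definition qfactr (R : realType) (q x : R) : R := qfact q (Num.truncn x).

Definition qpoch (R : realType) (q a : R) (k : nat) : R :=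
  \prod_(i < k) qnum q (a + i%:R).

Definition qhyp32_term (R : realType) (q a1 a2 a3 b1 b2 z : R) (k : nat) : R :=
  qpoch q a1 k * qpoch q a2 k * qpoch q a3 k / (qpoch q b1 k * qpoch q b2 k)
  * (z ^+ k / qfact q k).

(* The values - a_i over those a_i that are non-positive integers. *)
Definition stops (R : realType) (s : seq R) : seq nat :=
  [seq Num.truncn (- a) | a <- s & - a \is a Num.nat].

(* The explicit truncation matters when some b_i is a non-positive integer:
   the omitted terms would otherwise be of the form 0 / 0. *)
Definition qhyp32 (R : realType) (q a1 a2 a3 b1 b2 z : R) : R :=
  let t := qhyp32_term q a1 a2 a3 b1 b2 z in
  if stops [:: a1; a2; a3] is k :: ks then \sum_(i < (foldr minn k ks).+1) t i
  else limn (series t).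

(* D^j is realised as the space of column vectors of size 2j+1; the i-th
   coordinate is the one along |j m> with m = -j + i. *)
Definition dimD (R : realType) (j : R) : nat := (Num.truncn (2 * j)).+1.

Definition weight (R : realType) (j : R) (i : 'I_(dimD j)) : R := - j + i%:R.

(* |j m>, and 0 when m is not one of -j, -j+1, ..., j. *)
Definition ket (R : realType) (j m : R) : 'cV[R[i]]_(dimD j) :=
  \col_i (weight i == m)%:R.

(* Column k of each of the following matrices is the image of |j m>, m = weight k. *)
Definition Jminus (R : realType) (q j : R) : 'M[R[i]]_(dimD j) :=
  \matrix_(i, k) let m := weight k in
    (Num.sqrt (qnum q (j + m) * qnum q (j - m + 1)))%:C * ket j (m - 1) i 0.

Definition Jplus (R : realType) (q j : R) : 'M[R[i]]_(dimD j) :=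
  \matrix_(i, k) let m := weight k in
    (Num.sqrt (qnum q (j - m) * qnum q (j + m + 1)))%:C * ket j (m + 1) i 0.

Definition qJ0 (R : realType) (q a j : R) : 'M[R[i]]_(dimD j) :=
  \matrix_(i, k) let m := weight k in (q `^ (a * m))%:C * ket j m i 0.

Definition Jminus12 (R : realType) (q j1 j2 : R) : 'M[R[i]]_(dimD j1 * dimD j2) :=
  Jminus q j1 *t qJ0 q 1 j2 + qJ0 q (-1) j1 *t Jminus q j2.

Definition Jplus12 (R : realType) (q j1 j2 : R) : 'M[R[i]]_(dimD j1 * dimD j2) :=
  Jplus q j1 *t qJ0 q 1 j2 + qJ0 q (-1) j1 *t Jplus q j2.

Definition ket12 (R : realType) (j1 m1 j2 m2 : R) : 'cV[R[i]]_(dimD j1 * dimD j2) :=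
  ket j1 m1 *t ket j2 m2.

Definition inner (R : realType) (n : nat) (u v : 'cV[R[i]]_n) : R[i] :=
  \sum_i Num.conj (u i 0) * v i 0.

Definition hnorm (R : realType) (n : nat) (v : 'cV[R[i]]_n) : R[i] :=
  sqrtC (inner v v).

(* The sum over r >= 0 is cut at the dimension of the space: the nilpotent
   operator J_+(12) vanishes when raised to that power. *)
Definition Pproj (R : realType) (q j1 j2 j m : R) : 'M[R[i]]_(dimD j1 * dimD j2) :=
  (Num.sqrt (qfactr q (j + m) / (qfactr q (2 * j) * qfactr q (j - m))))%:C *:
  \sum_(r < dimD j1 * dimD j2)
    ((-1) ^+ r * qfactr q (2 * j + 1)
       / (qfact q r * qfactr q (2 * j + r%:R + 1)))%:C *:
    (Jminus12 q j1 j2 ^+ (r + Num.truncn (j - m)) * Jplus12 q j1 j2 ^+ r).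

Definition coupled (R : realType) (q j1 j2 j m : R) : 'cV[R[i]]_(dimD j1 * dimD j2) :=
  let v := Pproj q j1 j2 j m *m ket12 j1 j1 j2 (j - j1) in
  (hnorm v)^-1 *: v.

(* The basis being orthonormal, the coefficient of |j1 m1>|j2 m2> is an inner
   product. *)
Definition CG (R : realType) (q j1 m1 j2 m2 j m : R) : R[i] :=
  inner (ket12 j1 m1 j2 m2) (coupled q j1 j2 j m).

Definition Gamma_CG (R : realType) (q j1 j2 j m1 m2 m : R) : R :=
  q `^ (j1 * m2 - j2 * m1 - 2^-1 * (j1 + j2 - j) * (j1 + j2 + j + 1))
  * qfactr q (2 * j2) * qfactr q (j1 + j2 - m)
  * Num.sqrt (qnum q (2 * j + 1) * qfactr q (j + m) * qfactr q (j + j1 - j2))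
  / Num.sqrt (qfactr q (j1 + j2 + j + 1) * qfactr q (j + j2 - j1)
              * qfactr q (j1 + j2 - j) * qfactr q (j1 + m1) * qfactr q (j1 - m1)
              * qfactr q (j2 + m2) * qfactr q (j2 - m2) * qfactr q (j - m)).

Definition is_spin (R : realType) (j : R) : Prop := 2 * j \is a Num.nat.

Definition is_weight (R : realType) (j m : R) : Prop :=
  exists2 k : nat, m = - j + k%:R & m <= j.

Definition couples (R : realType) (j1 j2 j : R) : Prop :=
  exists2 k : nat, j = `|j1 - j2| + k%:R & j <= j1 + j2.

(* Main.v *)
Require Import Defs.
From mathcomp Require Import all_boot all_order all_algebra.
From mathcomp Require Import all_classical all_reals all_analysis.
From mathcomp Require Import complex mxtens ring lra zify.

Import Order.TTheory GRing.Theory Num.Theory.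

Local Open Scope ring_scope.
Local Open Scope complex_scope.

Set Implicit Arguments.
Unset Strict Implicit.
Unset Printing Implicit Defensive.

(** Write [a = j1 - m1] and [p = j2 - m2] for the depths below the top weights, and rescale
the basis so that no square roots are left: a vector becomes a function [G a p], the
coefficient being [sqrt (depth_weight a p) * G a p].  The ladder operators become
[lower] and [raise], which make sense for all natural [a], [p].

The commutation relation gives [raise (P u) = 0] for the extremal projector [P], and a
vector of depth [k = j1 + j2 - j] killed by [raise] is unique up to a scalar; adjointness
of [lower] and [raise] gives the sign of that scalar.  On the other side, the polynomial
[cg_poly] underlying the 3F2 satisfies [lower cg_poly = cg_poly] term by term above
depth [k], while at depth [k] the q-Chu-Vandermonde sum turns it into a product, which is
visibly the highest-weight vector.  What remains is its norm: one more q-binomial sum at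
depth [k], and the commutation relation below. *)

(** * q-numbers and q-sums *)

Section QNumbers.
Variables (R : realType) (q : R).
Hypotheses (q_gt0 : 0 < q) (q_lt1 : q < 1).

Lemma qpow_gt0 (x : R) : 0 < q `^ x.
Proof. by rewrite powR_gt0. Qed.

Lemma qpow_neq0 (x : R) : q `^ x != 0.
Proof. by rewrite gt_eqF ?qpow_gt0. Qed.

Lemma qpowD (x y : R) : q `^ (x + y) = q `^ x * q `^ y.
Proof. by apply: powRD; apply/implyP => _; rewrite gt_eqF. Qed.

Lemma qpowB (x y : R) : q `^ (x - y) = q `^ x / q `^ y.
Proof. by rewrite qpowD powRN. Qed.

Lemma qdiff_neq0 : q - q^-1 != 0.
Proof. by rewrite lt_eqF// subr_lt0 (lt_trans q_lt1)// invf_gt1. Qed.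

Lemma qqB1_neq0 : q * q - 1 != 0.
Proof.
have -> : q * q - 1 = q * (q - q^-1) by field; rewrite gt_eqF.
by rewrite mulf_neq0 ?qdiff_neq0 // gt_eqF.
Qed.

Lemma qnumD (x y : R) : qnum q (x + y) = q `^ (- y) * qnum q x + q `^ x * qnum q y.
Proof.
rewrite /qnum opprD !qpowD !powRN; field.
by rewrite qqB1_neq0 !qpow_neq0 gt_eqF.
Qed.

Lemma qnumN (x : R) : qnum q (- x) = - qnum q x.
Proof. by rewrite /qnum opprK -mulNr opprB. Qed.

Lemma qnum0 : qnum q 0 = 0.
Proof. by rewrite /qnum oppr0 subrr mul0r. Qed.

Lemma qnum1 : qnum q 1 = 1.
Proof. by rewrite /qnum powRN powRr1 ?ltW // divff ?qdiff_neq0. Qed.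

Lemma qnum_gt0 (x : R) : 0 < x -> 0 < qnum q x.
Proof.
move=> x0; have qx : q `^ x < 1.
  by have := gt0_ltr_powR x0 _ _ q_lt1; rewrite powR1 !nnegrE ltW //; apply; rewrite // ler01.
rewrite /qnum -mulrNN; apply: mulr_gt0.
  by rewrite oppr_gt0 subr_lt0 powRN (lt_trans qx) // invf_gt1 ?qpow_gt0.
by rewrite oppr_gt0 invr_lt0 subr_lt0 (lt_trans q_lt1) // invf_gt1.
Qed.

Lemma qnum_ge0 (x : R) : 0 <= x -> 0 <= qnum q x.
Proof.
by rewrite le_eqVlt => /predU1P[<-|/qnum_gt0/ltW//]; rewrite qnum0.
Qed.

Lemma qfact0 : qfact q 0 = 1.
Proof. by rewrite /qfact big_geq. Qed.

Lemma qfactS n : qfact q n.+1 = qfact q n * qnum q n.+1%:R.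
Proof. by rewrite /qfact big_nat_recr. Qed.

Lemma qfact_gt0 n : 0 < qfact q n.
Proof.
by elim: n => [|n IH]; rewrite ?qfact0// qfactS mulr_gt0// qnum_gt0// ltr0n.
Qed.

Lemma qfact_neq0 n : qfact q n != 0.
Proof. by rewrite gt_eqF ?qfact_gt0. Qed.

Lemma qnumS_neq0 n : qnum q n.+1%:R != 0.
Proof. by rewrite gt_eqF ?qnum_gt0 ?ltr0n. Qed.

Lemma qfactr_nat n : qfactr q n%:R = qfact q n.
Proof. by rewrite /qfactr natrK. Qed.

(** The q-falling factorial: up to the sign (-1)^r it is the symbol [(-x|q)_r]. At a natural x it
    vanishes once r exceeds x, so sums containing it tolerate any larger cutoff. *)
Definition qfall (x : R) (r : nat) : R := \prod_(i < r) qnum q (x - i%:R).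

Lemma qfall0 x : qfall x 0 = 1.
Proof. by rewrite /qfall big_ord0. Qed.

Lemma qfallSr x r : qfall x r.+1 = qfall x r * qnum q (x - r%:R).
Proof. by rewrite /qfall big_ord_recr. Qed.

Lemma qfallSl x r : qfall x r.+1 = qnum q x * qfall (x - 1) r.
Proof.
rewrite /qfall big_ord_recl subr0; congr (_ * _); apply: eq_bigr => i _.
by rewrite lift0 -[i.+1]add1n natrD; congr qnum; ring.
Qed.

Lemma qpochN x r : qpoch q (- x) r = (-1) ^+ r * qfall x r.
Proof.
elim: r => [|r IH]; first by rewrite /qpoch qfall0 big_ord0 mul1r.
rewrite /qpoch big_ord_recr /= -[\prod_(i < r) _]/(qpoch q (- x) r) IH qfallSr exprS.
by have -> : - x + r%:R = - (x - r%:R); [ring | rewrite qnumN; ring].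
Qed.

Lemma qfall_nat n r : (r <= n)%N -> qfall n%:R r * qfact q (n - r) = qfact q n.
Proof.
elim: r => [|r IH] h; first by rewrite qfall0 mul1r subn0.
rewrite -IH ?(ltnW h)// qfallSr -mulrA; congr (_ * _).
by rewrite -natrB ?(ltnW h)// -(subnSK h) qfactS mulrC.
Qed.

Lemma qfall_small n r : (n < r)%N -> qfall n%:R r = 0.
Proof.
move=> h; rewrite /qfall (bigD1 (Ordinal h)) //= subrr qnum0 mul0r //.
Qed.

End QNumbers.

(** * Two terminating q-hypergeometric sums *)

Section QSums.
Variables (R : realType) (q : R).
Hypotheses (q_gt0 : 0 < q) (q_lt1 : q < 1).

Local Notation "[[ n ]]" := (qfact q n) (format "[[ n ]]").
Let qD := qnumD q_gt0 q_lt1.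
Let f0 := qfact_neq0 q_gt0 q_lt1.
Let n0 := qnumS_neq0 q_gt0 q_lt1.
Let p0 := qpow_neq0 q_gt0.

(** Induction on p. Splitting [[p+1]] along [(p - i) + (i + 1)] turns the sum for p+1 into the sum
    for p with N+1 and, shifted by one index, the sum for p with N. Any K >= p is a valid cutoff
    because [qfall] vanishes beyond p. *)
Lemma q_chu_vandermonde (p N d K : nat) : (p <= K)%N -> (p <= N)%N ->
  \sum_(r < K.+1) (-1) ^+ r * q `^ ((d%:R + p%:R) * r%:R)
     * (qfall q p%:R r / [[r]]) * ([[N - r]] / [[(N + d).+1 - r]])
  = (-1) ^+ p * q `^ (p%:R * (N%:R + d%:R + 1))
     * ([[N - p]] * [[d + p]]) / ([[(N + d).+1]] * [[d]]).
Proof.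
elim: p N K => [|p IH] N K.
  move=> _ _; rewrite big_ord_recl big1 => [|i _] /=; last by rewrite qfall_small // mul0r mulr0 mul0r.
  rewrite qfall0 qfact0 !subn0 mulr0 mul0r addn0 !powRr0.
    by field; rewrite !f0.
case: K N => // K [|N] // pK pN.
rewrite big_ord_recl.
have -> : \sum_(i < K.+1)
   (-1) ^+ lift ord0 i * q `^ ((d%:R + p.+1%:R) * (lift ord0 i)%:R) *
   (qfall q p.+1%:R (lift ord0 i) / [[lift ord0 i]]) *
   ([[N.+1 - lift ord0 i]] / [[(N.+1 + d).+1 - lift ord0 i]]) =
  \sum_(i < K.+1)
   (-1) ^+ lift ord0 i * q `^ ((d%:R + p%:R) * (lift ord0 i)%:R) *
   (qfall q p%:R (lift ord0 i) / [[lift ord0 i]]) *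
   ([[N.+1 - lift ord0 i]] / [[(N.+1 + d).+1 - lift ord0 i]]) -
  q `^ (d%:R + 1 + 2 * p%:R) * (\sum_(r < K.+1) (-1) ^+ r * q `^ ((d%:R + p%:R) * r%:R)
     * (qfall q p%:R r / [[r]]) * ([[N - r]] / [[(N + d).+1 - r]])).
  rewrite mulr_sumr -sumrB; apply: eq_bigr => i _.
  rewrite lift0 /= qfallSl -natr1 addrK qfallSr !subSS exprS qfactS.
  have -> : p%:R + 1 = (p%:R - i%:R) + i.+1%:R :> R by rewrite -natr1; ring.
  rewrite (qD (_ - _)) !addSn.
  have -> : (d%:R + (p%:R - i%:R + i.+1%:R)) * i.+1%:R =
    (d%:R + p%:R) * i%:R + (d%:R + p%:R) + i.+1%:R :> R by rewrite -natr1; ring.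
  have -> : (d%:R + p%:R) * i.+1%:R = (d%:R + p%:R) * i%:R + (d%:R + p%:R) :> R.
    by rewrite -natr1; ring.
  have -> : d%:R + 1 + 2 * p%:R = (d%:R + p%:R) + (p%:R - i%:R) + i.+1%:R :> R.
    by rewrite -natr1; ring.
  rewrite !(qpowD q_gt0) !powRN.
  by field; rewrite !p0 n0 !f0.
rewrite addrA (IH N K) //.
have := IH N.+1 K.+1 (leqW pK) (leqW pN).
rewrite big_ord_recl /= !qfall0 !mulr0 !powRr0 => ->.
have E : (N.+1 - p = (N - p).+1)%N by lia.
rewrite E subSS addnS !addSn !qfactS exprS -E.
(* The addition rule for [[N+d+2]], solved for [[N+1-p]], merges the two values given by the
   induction hypothesis. *)
have -> : qnum q (N.+1 - p)%:R = q `^ (d + p).+1%:R * qnum q (N + d).+2%:R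
    - q `^ (N.+1 - p)%:R * q `^ (d + p).+1%:R * qnum q (d + p).+1%:R.
  have -> : (N + d).+2%:R = (N.+1 - p)%:R + (d + p).+1%:R :> R.
    by rewrite -natrD; congr (_%:R); lia.
  by rewrite qD powRN; field; rewrite p0.
have -> : d%:R + 1 + 2 * p%:R = p%:R + (d + p).+1%:R :> R by rewrite -!natr1 natrD; ring.
have -> : p.+1%:R * (N.+1%:R + d%:R + 1) = p%:R * (N%:R + d%:R + 1) + p%:R + (N.+1 - p)%:R + (d + p).+1%:R :> R.
  by rewrite -!natr1 natrD natrB ?(leq_trans pN) //-?natr1; [ring | lia].
have -> : p%:R * (N.+1%:R + d%:R + 1) = p%:R * (N%:R + d%:R + 1) + p%:R :> R.
  by rewrite -!natr1; ring.
rewrite !qpowD //.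
by field; rewrite !f0 !n0.
Qed.

(** Induction on k after multiplying by [[k+1] = q^p [k+1-p] + q^(p-k-1) [p]]: each part cancels one
    factor of the denominator, which leaves two sums of the same shape for k, one with x and one
    with y raised by one. *)
Lemma sum_qbin_diagonal (k x y : nat) :
  \sum_(p < k.+1) q `^ (p%:R * (x%:R + y%:R + 2))
     * ([[y + p]] * [[x + (k - p)]] / ([[p]] * [[k - p]]))
  = q `^ (k%:R * (y%:R + 1)) * ([[x]] * [[y]] * [[(x + y + k).+1]])
     / ([[(x + y).+1]] * [[k]]).
Proof.
elim: k x y => [|k IH] x y.
  rewrite big_ord1 !mul0r !powRr0 qfact0 !addn0 mul1r.
  by field; rewrite !f0 .
apply: (mulfI (n0 k)); rewrite mulr_sumr.
transitivity (\sum_(p < k.+2) (q `^ (p%:R * (x%:R + y%:R + 3)) *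
    (qnum q (k.+1 - p)%:R * [[y + p]] * [[x + (k.+1 - p)]] / ([[p]] * [[k.+1 - p]])) +
    q `^ (p%:R * (x%:R + y%:R + 3) - k.+1%:R) *
    (qnum q p%:R * [[y + p]] * [[x + (k.+1 - p)]] / ([[p]] * [[k.+1 - p]])))).
  apply: eq_bigr => p _.
  have -> : qnum q k.+1%:R = q `^ p%:R * qnum q (k.+1 - p)%:R
       + q `^ (p%:R - k.+1%:R) * qnum q p%:R.
    have -> : k.+1%:R = p%:R + (k.+1 - p)%:R :> R by rewrite -natrD subnKC // -ltnS.
    by rewrite qD opprD addrA subrr add0r addrC.
  have -> : p%:R * (x%:R + y%:R + 3) = p%:R * (x%:R + y%:R + 2) + p%:R :> R by ring.
  rewrite !(qpowD q_gt0) powRN.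
  by field; rewrite !f0 p0.
(* The end terms, p = k+1 in the first sum and p = 0 in the second, vanish because [[0] = 0]. *)
rewrite big_split /= big_ord_recr /= [X in _ + X]big_ord_recl /=.
rewrite subnn qnum0 !(mul0r, mulr0) addr0 add0r.
transitivity (
  \sum_(p < k.+1) q `^ (p%:R * (x.+1%:R + y%:R + 2))
     * ([[y + p]] * [[x.+1 + (k - p)]] / ([[p]] * [[k - p]])) +
  q `^ (x%:R + y%:R + 2 - k%:R) *
  \sum_(p < k.+1) q `^ (p%:R * (x%:R + y.+1%:R + 2))
     * ([[y.+1 + p]] * [[x + (k - p)]] / ([[p]] * [[k - p]]))).
  congr (_ + _); last rewrite mulr_sumr; apply: eq_bigr => p _.
    have pk : (p <= k)%N by rewrite -ltnS.
    rewrite subSn // addnS addSn !qfactS.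
    have -> : x.+1%:R + y%:R + 2 = x%:R + y%:R + 3 :> R by rewrite -natr1; ring.
    by field; rewrite !f0 n0.
  rewrite /bump add1n subSS addnS addSn !qfactS.
  have -> : p.+1%:R * (x%:R + y%:R + 3) - k.+1%:R =
      (x%:R + y%:R + 2 - k%:R) + p%:R * (x%:R + y.+1%:R + 2) :> R.
    by rewrite -!natr1; ring.
  by rewrite (qpowD q_gt0 (_ - _)); field; rewrite !f0 n0.
rewrite !IH !addSn !addnS addSn !qfactS.
have -> : k.+1%:R * (y%:R + 1) = k%:R * (y%:R + 1) + y.+1%:R :> R by rewrite -!natr1; ring.
have -> : k%:R * (y.+1%:R + 1) = k%:R * (y%:R + 1) + k%:R :> R by rewrite -!natr1; ring.
have -> : x%:R + y%:R + 2 = x.+1%:R + y.+1%:R :> R by rewrite -!natr1; ring.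
rewrite !(qpowD q_gt0) !powRN.
have -> : qnum q x.+1%:R = q `^ y.+1%:R * qnum q (x + y).+2%:R - q `^ x.+1%:R * q `^ y.+1%:R * qnum q y.+1%:R.
  have -> : (x + y).+2%:R = x.+1%:R + y.+1%:R :> R by rewrite -natrD addSn addnS.
  by rewrite qD powRN; field; rewrite p0.
by field; rewrite !f0 !n0 !p0.
Qed.

(** * The polynomial part of the coefficients *)

Section Coefficients.
Variables (n1 n2 k : nat).

(* The 3F2 of the theorem for [k = j1 + j2 - j], up to a factor that depends on [a + p]
   only; [qfall] makes the terms with [r > p] vanish. *)
Definition cg_poly (a p : nat) : R :=
  \sum_(r < k.+1) (-1) ^+ r * q `^ ((n1%:R - a%:R) * r%:R)
    * ([[n2 - r]] / ([[k - r]] * [[(n1 + n2 - k).+1 - r]] * [[r]]))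
    * (qfall q p%:R r * [[a + p - r]]).

(** Holds for each r separately, from [[a+p-r] = q^(r-p) [a] + q^a [p-r]]: the first summand gives
    the term with a-1, the second, absorbed by [qfall], the term with p-1. The hypothesis keeps
    a+p-r positive for all r <= k, so [[a+p-r]!] has a last factor to split off. *)
Lemma cg_poly_lower (a p : nat) : (k < a + p)%N ->
  cg_poly a p = q `^ (- p%:R) * qnum q a%:R * cg_poly a.-1 p
              + q `^ a%:R * qnum q p%:R * cg_poly a p.-1.
Proof.
move=> kap; rewrite /cg_poly !mulr_sumr -big_split; apply: eq_bigr => r _ /=.
have rk : (r <= k)%N by rewrite -ltnS.
have [pr|rp] := ltnP p r.
  rewrite !qfall_small //; last by rewrite (leq_ltn_trans _ pr) // leq_pred.
  by ring.
have h1 : qfall q p%:R r * qnum q (p%:R - r%:R) = qnum q p%:R * qfall q p.-1%:R r.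
  case: p {kap rp} => [|p]; last by rewrite -qfallSr qfallSl -natr1 addrK.
  rewrite qnum0 mul0r sub0r; case: (val r) => [|n]; first by rewrite oppr0 qnum0 mulr0.
  by rewrite qfall_small // mul0r.
(* At a = 0 or p = 0 the truncated predecessor does no harm in [h2], [h3] and [h5], since it is
   multiplied by [[0]]. *)
have h2 : qnum q a%:R * [[a.-1 + p - r]] = qnum q a%:R * [[(a + p - r).-1]].
  case: a {kap} => [|a]; first by rewrite qnum0 !mul0r.
  by congr (_ * qfact _ _) => /=; lia.
have h3 : qnum q p%:R * qfall q p.-1%:R r * [[a + p.-1 - r]]
    = qnum q p%:R * qfall q p.-1%:R r * [[(a + p - r).-1]].
  case: p {h1 h2 rp} kap => [|p] kap; first by rewrite qnum0 !mul0r.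
  by congr (_ * qfact _ _) => /=; lia.
have h4 : [[a + p - r]] = [[(a + p - r).-1]] *
    (q `^ (r%:R - p%:R) * qnum q a%:R + q `^ a%:R * qnum q (p%:R - r%:R)).
  have -> : (a + p - r = (a + p - r).-1.+1)%N by lia.
  rewrite qfactS /= -(opprB p%:R r%:R) -qD; congr (_ * qnum _ _).
  rewrite prednK; last by lia.
  by rewrite natrB ?natrD ?addrA //; lia.
have h5 : q `^ (- p%:R) * qnum q a%:R * q `^ ((n1%:R - a.-1%:R) * r%:R)
    = q `^ (r%:R - p%:R) * qnum q a%:R * q `^ ((n1%:R - a%:R) * r%:R).
  case: a {kap h2 h3 h4} => [|a]; first by rewrite qnum0 !(mulr0, mul0r).
  have -> : (n1%:R - a%:R) * r%:R = (n1%:R - a.+1%:R) * r%:R + r%:R :> R.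
    by rewrite -natr1; ring.
  by rewrite !qpowD //; ring.
set X := _ / _; set Y := (-1) ^+ r.
transitivity (Y * X * q `^ ((n1%:R - a%:R) * r%:R) * (qfall q p%:R r * [[a + p - r]])); first by ring.
transitivity (Y * X * ((q `^ (- p%:R) * qnum q a%:R * q `^ ((n1%:R - a.-1%:R) * r%:R)) *
    qfall q p%:R r * [[(a + p - r).-1]] + q `^ a%:R * q `^ ((n1%:R - a%:R) * r%:R) *
    (qnum q p%:R * qfall q p.-1%:R r * [[(a + p - r).-1]]))); last first.
  rewrite -h3.
  transitivity (Y * X * (q `^ (- p%:R) * q `^ ((n1%:R - a.-1%:R) * r%:R) *
    qfall q p%:R r * (qnum q a%:R * [[(a + p - r).-1]]) + q `^ a%:R * q `^ ((n1%:R - a%:R) * r%:R) *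
    (qnum q p%:R * qfall q p.-1%:R r * [[a + p.-1 - r]]))); first by ring.
  by rewrite -h2; ring.
by rewrite h5 -h1 h4; ring.
Qed.

Hypotheses (k_le1 : (k <= n1)%N) (k_le2 : (k <= n2)%N).

(** For a + p = k the factors [[a+p-r]!] and [[k-r]!] cancel, which leaves the q-Chu-Vandermonde sum
    with N = n2 and d = n1 - k. *)
Lemma cg_poly_highest (a p : nat) : (a + p = k)%N ->
  cg_poly a p = (-1) ^+ p * q `^ (p%:R * (n1 + n2 - k).+1%:R) * ([[n2 - p]] * [[n1 - a]])
    / ([[(n1 + n2 - k).+1]] * [[n1 - k]]).
Proof.
move=> apk; have [pk pn] : (p <= k /\ p <= n2)%N by lia.
have := q_chu_vandermonde (n1 - k) pk pn.
have -> : (n2 + (n1 - k) = n1 + n2 - k)%N by lia.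
have -> : (n1 - k + p = n1 - a)%N by lia.
have -> : (n1 + n2 - k).+1%:R = n2%:R + (n1 - k)%:R + 1 :> R.
  by rewrite -natr1 -natrD; congr (_%:R + 1); lia.
set S := \sum_(r < _) _ => SE.
transitivity S; last by rewrite SE; field; rewrite !f0.
apply: eq_bigr => r _; rewrite apk.
have -> : n1%:R - a%:R = (n1 - k)%:R + p%:R :> R by rewrite -natrD -natrB; [congr (_%:R)|]; lia.
by field; rewrite !f0.
Qed.

End Coefficients.
End QSums.

(** * Ladder operators in depth coordinates *)

Section Ladder.
Variables (R : realType) (q : R).
Hypotheses (q_gt0 : 0 < q) (q_lt1 : q < 1).
Variables (n1 n2 : nat).

Local Notation "[[ n ]]" := (qfact q n) (format "[[ n ]]").
Let f0 := qfact_neq0 q_gt0 q_lt1.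
Let n0 := qnumS_neq0 q_gt0 q_lt1.
Let p0 := qpow_neq0 q_gt0.

(* Matrix entries of [Jminus12], [Jplus12] in the basis rescaled by [depth_weight]. The
   arguments of [raise] are real differences rather than truncated ones, so that the
   commutation relation holds on all of nat x nat. *)
Definition lower (G : nat -> nat -> R) (a p : nat) : R :=
  q `^ (- p%:R) * qnum q a%:R * G a.-1 p + q `^ a%:R * qnum q p%:R * G a p.-1.

Definition raise (G : nat -> nat -> R) (a p : nat) : R :=
  q `^ (n2%:R - p%:R) * qnum q (n1%:R - a%:R) * G a.+1 p
  + q `^ (a%:R - n1%:R) * qnum q (n2%:R - p%:R) * G a p.+1.

Definition at_depth (t : nat) (G : nat -> nat -> R) : Prop :=
  forall a p, (a + p)%N != t -> G a p = 0.

Definition zero2 : nat -> nat -> R := fun _ _ => 0.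

Lemma lower_zero2 : lower zero2 = zero2.
Proof. by apply/funext => a; apply/funext => p; rewrite /lower !mulr0 addr0. Qed.

Lemma iter_lower_zero2 r : iter r lower zero2 = zero2.
Proof. by elim: r => //= r ->; rewrite lower_zero2. Qed.

Lemma raise_zero2 : raise zero2 = zero2.
Proof. by apply/funext => a; apply/funext => p; rewrite /raise !mulr0 addr0. Qed.

Lemma iter_raise_zero2 r : iter r raise zero2 = zero2.
Proof. by elim: r => //= r ->; rewrite raise_zero2. Qed.

Lemma lower_at_depth t G : at_depth t G -> at_depth t.+1 (lower G).
Proof.
move=> Gt a p apt; rewrite /lower.
case: a apt => [|a] apt; case: p apt => [|p] apt /=; rewrite ?qnum0 ?(mulr0, mul0r) ?add0r ?addr0 //.
- by rewrite (Gt 0%N) ?mulr0 //; lia.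
- by rewrite (Gt a) ?mulr0 //; lia.
by rewrite (Gt a) ?(Gt a.+1) ?mulr0 ?addr0 //; lia.
Qed.

Lemma raise_at_depth t G : at_depth t.+1 G -> at_depth t (raise G).
Proof.
by move=> Gt a p apt; rewrite /raise (Gt a.+1) ?(Gt a) ?mulr0 ?addr0 //; lia.
Qed.

Lemma raise_at_depth0 G : at_depth 0 G -> raise G = zero2.
Proof.
move=> Gt; apply/funext => a; apply/funext => p.
by rewrite /raise (Gt a.+1) ?(Gt a) ?mulr0 ?addr0 //; lia.
Qed.

Lemma iter_lower_at_depth t r G : at_depth t G -> at_depth (t + r) (iter r lower G).
Proof.
by move=> Gt; elim: r => [|r IH]; rewrite ?addn0 // addnS; apply: lower_at_depth.
Qed.

Lemma iter_raise_at_depth t r G : (r <= t)%N -> at_depth t G ->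
  at_depth (t - r) (iter r raise G).
Proof.
move=> rt Gt; elim: r rt => [|r IH] rt; first by rewrite subn0.
by apply: raise_at_depth; rewrite subnSK //; apply: IH; apply: ltnW.
Qed.

Lemma iter_raise_nilpotent t r G : (t < r)%N -> at_depth t G -> iter r raise G = zero2.
Proof.
move=> tr Gt; rewrite -(subnK tr) iterD iterS.
have := iter_raise_at_depth (leqnn t) Gt; rewrite subnn => /raise_at_depth0 ->.
by rewrite iter_raise_zero2.
Qed.

(** The relation [[J_+, J_-] = [2 J_0]_q]: at depth t the eigenvalue of [2 J_0(12)] is n1 + n2 -
    2t. *)
Lemma raise_lower t G a p : at_depth t G ->
  raise (lower G) a p =
    lower (raise G) a p + qnum q ((n1 + n2)%:R - 2 * t%:R) * G a p.
Proof.
move=> Gt.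
have -> : qnum q ((n1 + n2)%:R - 2 * t%:R) * G a p =
    qnum q ((n1 + n2)%:R - 2 * (a + p)%:R) * G a p.
  by have [<-//|/Gt ->] := eqVneq (a + p)%N t; rewrite !mulr0.
(* The coefficient of [G a p] itself in the commutator. The remaining terms move one unit of depth
   between the two tensor factors and agree in both orders ([cross1], [cross2]). *)
have diag : qnum q ((n1 + n2)%:R - 2 * (a + p)%:R) =
    q `^ (n2%:R - p%:R) * qnum q (n1%:R - a%:R) * (q `^ (- p%:R) * qnum q a.+1%:R)
    - q `^ (- p%:R) * qnum q a%:R * (q `^ (n2%:R - p%:R) * qnum q (n1%:R - a%:R + 1))
    + q `^ (a%:R - n1%:R) * qnum q (n2%:R - p%:R) * (q `^ a%:R * qnum q p.+1%:R)
    - q `^ a%:R * qnum q p%:R * (q `^ (a%:R - n1%:R) * qnum q (n2%:R - p%:R + 1)).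
  have -> : (n1 + n2)%:R - 2 * (a + p)%:R = n1%:R + n2%:R - a%:R - a%:R - p%:R - p%:R :> R.
    by rewrite !natrD; ring.
  rewrite /qnum -!natr1.
  rewrite !(opprD, opprK) !(qpowD q_gt0) !powRN !powRr1 ?(ltW q_gt0) //.
  by field; rewrite !p0 qqB1_neq0 // gt_eqF.
rewrite diag /raise /lower.
have cross1 : q `^ (n2%:R - p%:R) * qnum q (n1%:R - a%:R) * (q `^ a.+1%:R * qnum q p%:R * G a.+1 p.-1)
   = q `^ a%:R * qnum q p%:R * (q `^ (n2%:R - p.-1%:R) * qnum q (n1%:R - a%:R) * G a.+1 p.-1).
  case: p {diag} => [|p]; first by rewrite qnum0 !(mul0r, mulr0).
  by rewrite /= -!natr1 !(opprD, opprK) !(qpowD q_gt0) !powRN; field; rewrite !p0.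
have cross2 : q `^ (a%:R - n1%:R) * qnum q (n2%:R - p%:R) *
     (q `^ (- p.+1%:R) * qnum q a%:R * G a.-1 p.+1)
   = q `^ (- p%:R) * qnum q a%:R * (q `^ (a.-1%:R - n1%:R) * qnum q (n2%:R - p%:R) * G a.-1 p.+1).
  case: a {diag cross1} => [|a]; first by rewrite qnum0 !(mul0r, mulr0).
  by rewrite /= -!natr1 !(opprD, opprK) !(qpowD q_gt0) !powRN; field; rewrite !p0.
(* [a.-1.+1] differs from a only at a = 0, where [[a]] vanishes; [back2] does the same for p. *)
have back1 : qnum q a%:R * (q `^ (n2%:R - p%:R) * qnum q (n1%:R - a.-1%:R) * G a.-1.+1 p)
  = qnum q a%:R * (q `^ (n2%:R - p%:R) * qnum q (n1%:R - a%:R + 1) * G a p).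
  case: a {diag cross1 cross2} => [|a]; first by rewrite qnum0 !mul0r.
  by do 3!congr (_ * _); congr qnum; rewrite -natr1 /=; ring.
have back2 : qnum q p%:R * (q `^ (a%:R - n1%:R) * qnum q (n2%:R - p.-1%:R) * G a p.-1.+1)
  = qnum q p%:R * (q `^ (a%:R - n1%:R) * qnum q (n2%:R - p%:R + 1) * G a p).
  case: p {diag cross1 cross2 back1} => [|p]; first by rewrite qnum0 !mul0r.
  by do 3!congr (_ * _); congr qnum; rewrite -natr1 /=; ring.
rewrite !mulrDr cross1 cross2 -!(mulrA (q `^ (- p%:R))) back1.
rewrite -!(mulrA (q `^ a%:R) (qnum q p%:R)) back2 /=.
by ring.
Qed.

(** The induction step for [[c] + [c-2] + ... + [c-2r] = [r+1][c-r]], with x = c - r: this is how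
    the commutators collected along a string of lowerings add up. *)
Lemma qnum_ladder (x r : R) :
  qnum q r * qnum q (x + 1) + qnum q (x - r) = qnum q (r + 1) * qnum q x.
Proof.
rewrite /qnum !opprD !opprK !(qpowD q_gt0) !powRN powRr1 ?ltW //.
by field; rewrite !p0 qqB1_neq0 // gt_eqF.
Qed.

Lemma raise_iter_lower t G r a p : at_depth t G ->
  raise (iter r.+1 lower G) a p = iter r.+1 lower (raise G) a p
    + qnum q r.+1%:R * qnum q ((n1 + n2)%:R - 2 * t%:R - r%:R) * iter r lower G a p.
Proof.
move=> Gt; elim: r a p => [|r IH] a p.
  by rewrite /= (raise_lower a p Gt) qnum1 // mul1r subr0.
rewrite iterS (raise_lower a p (iter_lower_at_depth (r := r.+1) Gt)).
have -> : raise (iter r.+1 lower G) = fun a p => iter r.+1 lower (raise G) a p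
    + qnum q r.+1%:R * qnum q ((n1 + n2)%:R - 2 * t%:R - r%:R) * iter r lower G a p.
  by apply/funext => b; apply/funext => s; rewrite IH.
have L := qnum_ladder ((n1 + n2)%:R - 2 * t%:R - r.+1%:R) r.+1%:R.
rewrite natr1 in L; rewrite -L.
have -> : (n1 + n2)%:R - 2 * t%:R - r.+1%:R + 1 = (n1 + n2)%:R - 2 * t%:R - r%:R :> R.
  by rewrite -natr1; ring.
have -> : (n1 + n2)%:R - 2 * (t + r.+1)%:R = (n1 + n2)%:R - 2 * t%:R - r.+1%:R - r.+1%:R :> R.
  by rewrite natrD; ring.
rewrite [iter r.+2 lower (raise G)]iterS [iter r.+1 lower G]iterS.
by rewrite /lower; ring.
Qed.

(** With n = 2j, the coefficients of the sum in [Pproj]. *)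
Definition extremal_coef (n r : nat) : R :=
  (-1) ^+ r * [[n.+1]] / ([[r]] * [[(n + r).+1]]).

Definition extremal (n D : nat) (G : nat -> nat -> R) (a p : nat) : R :=
  \sum_(r < D) extremal_coef n r * iter r lower (iter r raise G) a p.

(* Telescoping: the recursion for [extremal_coef] makes consecutive terms of
   [raise_iter_lower] cancel. *)
Lemma raise_extremal_partial k n G m a p : (n + 2 * k = n1 + n2)%N -> at_depth k G ->
  raise (extremal n m.+1 G) a p =
    extremal_coef n m * iter m lower (iter m.+1 raise G) a p.
Proof.
move=> nk Gk.
have split m' b s : extremal n m'.+1 G b s =
    extremal n m' G b s + extremal_coef n m' * iter m' lower (iter m' raise G) b s.
  by rewrite /extremal big_ord_recr.
elim: m => [|m IH].
  rewrite /raise !split /extremal !big_ord0 /=; rewrite /raise; ring.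
rewrite {1}/raise !(split m.+1).
transitivity (raise (extremal n m.+1 G) a p +
   extremal_coef n m.+1 * raise (iter m.+1 lower (iter m.+1 raise G)) a p).
  by rewrite /raise; ring.
rewrite IH; have [mk|km] := ltnP m k; last first.
  rewrite (iter_raise_nilpotent _ Gk) // [iter m.+2 _ _]iterS (iter_raise_nilpotent _ Gk) //.
  by rewrite raise_zero2 !iter_lower_zero2 raise_zero2 /zero2 !mulr0 addr0.
rewrite (raise_iter_lower m a p (iter_raise_at_depth mk Gk)) -iterS.
have -> : (n1 + n2)%:R - 2 * (k - m.+1)%:R - m%:R = (n + m).+2%:R :> R.
  have -> : (n1 + n2)%:R = n%:R + 2 * k%:R :> R by rewrite -nk natrD natrM.
  by rewrite natrB // -[(n + m).+2]addn2 -[m.+1]addn1 !natrD; ring.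
set X := iter m.+1 lower _ a p; set Y := iter m lower _ a p.
have -> : extremal_coef n m = - extremal_coef n m.+1 * (qnum q m.+1%:R * qnum q (n + m).+2%:R).
  by rewrite /extremal_coef exprS addnS !qfactS; field; rewrite !f0 !n0.
by ring.
Qed.

Lemma raise_extremal k n D G a p : (n + 2 * k = n1 + n2)%N -> (k < D)%N ->
  at_depth k G -> raise (extremal n D G) a p = 0.
Proof.
case: D => // D nk kD Gk; rewrite (raise_extremal_partial _ _ _ nk Gk).
by rewrite (iter_raise_nilpotent _ Gk) // iter_lower_zero2 mulr0.
Qed.

Lemma extremal_at_depth k n D G : at_depth k G -> at_depth k (extremal n D G).
Proof.
move=> Gk a p apk; rewrite /extremal big1 // => r _.
have [kr|rk] := ltnP k r.
  by rewrite (iter_raise_nilpotent kr Gk) iter_lower_zero2 mulr0.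
have := iter_lower_at_depth (r := r) (iter_raise_at_depth rk Gk).
by rewrite subnK // => ->; rewrite ?mulr0.
Qed.

End Ladder.

(** * The inner product in depth coordinates *)

Section WeightedProduct.
Variables (R : realType) (q : R).
Hypotheses (q_gt0 : 0 < q) (q_lt1 : q < 1).
Variables (n1 n2 : nat).

Local Notation "[[ n ]]" := (qfact q n) (format "[[ n ]]").
Local Notation lower := (lower q).
Local Notation raise := (raise q n1 n2).
Let f0 := qfact_neq0 q_gt0 q_lt1.
Let n0 := qnumS_neq0 q_gt0 q_lt1.
Let p0 := qpow_neq0 q_gt0.

(** Chosen to satisfy the balance equations [depth_weightSl] and [depth_weightSr], which make
    [lower] and [raise] adjoint and absorb the square roots of the matrix entries. *)
Definition depth_weight (a p : nat) : R :=
  q `^ (n2%:R * a%:R - n1%:R * p%:R) / ([[a]] * [[n1 - a]] * [[p]] * [[n2 - p]]).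

Lemma depth_weight_gt0 a p : 0 < depth_weight a p.
Proof. by rewrite divr_gt0 ?qpow_gt0 // !mulr_gt0 ?qfact_gt0. Qed.

Lemma depth_weightSl a p : (a < n1)%N ->
  depth_weight a.+1 p * (q `^ (- p%:R) * qnum q a.+1%:R) =
  depth_weight a p * (q `^ (n2%:R - p%:R) * qnum q (n1%:R - a%:R)).
Proof.
move=> an; rewrite /depth_weight -(natrB _ (ltnW an)) -(subnSK an).
have -> : n2%:R * a.+1%:R - n1%:R * p%:R = n2%:R * a%:R - n1%:R * p%:R + n2%:R :> R.
  by rewrite -natr1; ring.
rewrite !(qpowD q_gt0) !qfactS !powRN.
by field; rewrite !f0 !n0 !p0.
Qed.

Lemma depth_weightSr a p : (p < n2)%N ->
  depth_weight a p.+1 * (q `^ a%:R * qnum q p.+1%:R) =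
  depth_weight a p * (q `^ (a%:R - n1%:R) * qnum q (n2%:R - p%:R)).
Proof.
move=> pn; rewrite /depth_weight -(natrB _ (ltnW pn)) -(subnSK pn).
have -> : n2%:R * a%:R - n1%:R * p.+1%:R = n2%:R * a%:R - n1%:R * p%:R - n1%:R :> R.
  by rewrite -natr1; ring.
rewrite !(qpowD q_gt0) !qfactS !powRN.
by field; rewrite !f0 !n0 !p0.
Qed.

Definition wdot (F G : nat -> nat -> R) : R :=
  \sum_(a < n1.+1) \sum_(p < n2.+1) depth_weight a p * F a p * G a p.

(** Summation by parts through the balance equations. The boundary terms vanish: at 0 through [[0]],
    at the far end through [[n1 - n1]] and [[n2 - n2]]. *)
Lemma wdot_lower F G : wdot F (lower G) = wdot (raise F) G.
Proof.
rewrite /wdot.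
transitivity (\sum_(a < n1.+1) \sum_(p < n2.+1)
    (depth_weight a p * (q `^ (- p%:R) * qnum q a%:R)) * F a p * G a.-1 p +
  \sum_(a < n1.+1) \sum_(p < n2.+1)
    (depth_weight a p * (q `^ a%:R * qnum q p%:R)) * F a p * G a p.-1).
  rewrite -big_split; apply: eq_bigr => a _; rewrite -big_split; apply: eq_bigr => p _.
  by rewrite /lower /=; ring.
transitivity (\sum_(a < n1.+1) \sum_(p < n2.+1)
    (depth_weight a p * (q `^ (n2%:R - p%:R) * qnum q (n1%:R - a%:R))) * F a.+1 p * G a p +
  \sum_(a < n1.+1) \sum_(p < n2.+1)
    (depth_weight a p * (q `^ (a%:R - n1%:R) * qnum q (n2%:R - p%:R))) * F a p.+1 * G a p);
  last first.
  rewrite -big_split; apply: eq_bigr => a _; rewrite -big_split; apply: eq_bigr => p _.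
  by rewrite /raise /=; ring.
congr (_ + _); last apply: eq_bigr => a _.
  rewrite big_ord_recl [RHS]big_ord_recr /=.
  rewrite [X in X + _]big1 => [|p _]; last by rewrite qnum0 !(mulr0, mul0r).
  rewrite [X in _ = _ + X]big1 => [|p _]; last by rewrite subrr qnum0 !(mulr0, mul0r).
  rewrite add0r addr0; apply: eq_bigr => a _; apply: eq_bigr => p _.
  by rewrite /bump add1n /= depth_weightSl.
rewrite big_ord_recl [RHS]big_ord_recr /= qnum0 subrr qnum0 !(mulr0, mul0r) add0r addr0.
by apply: eq_bigr => p _; rewrite /bump add1n /= depth_weightSr.
Qed.

Lemma wdot_iter_lower r F G : wdot F (iter r lower G) = wdot (iter r raise F) G.
Proof. by elim: r F => // r IH F; rewrite iterS wdot_lower IH -iterSr. Qed.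

(** A term with r > 0 has [lower] outermost, which by adjointness acts on F as [raise] and gives
    zero; only r = 0, with coefficient 1, survives. *)
Lemma wdot_extremal n D F G : raise F = zero2 R -> wdot F (extremal q n1 n2 n D.+1 G) = wdot F G.
Proof.
move=> F0.
have -> : wdot F (extremal q n1 n2 n D.+1 G) = \sum_(r < D.+1) extremal_coef q n r *
     wdot F (iter r lower (iter r raise G)).
  rewrite /wdot /extremal; under [RHS]eq_bigr => r _ do rewrite mulr_sumr.
  rewrite [RHS]exchange_big; apply: eq_bigr => a _ /=.
  under [RHS]eq_bigr => r _ do rewrite mulr_sumr.
  rewrite [RHS]exchange_big; apply: eq_bigr => p _ /=.
  by rewrite mulr_sumr; apply: eq_bigr => r _; ring.
rewrite big_ord_recl big1 => [|i _].
  by rewrite /= /extremal_coef addr0 addn0 qfact0 mul1r; field; rewrite !f0.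
rewrite lift0 wdot_iter_lower iterSr F0 iter_raise_zero2.
rewrite /wdot big1 ?mulr0 // => a _; rewrite big1 // => p _.
by rewrite /zero2 mulr0 mul0r.
Qed.

(** Move one [lower] across the product. As F is killed by [raise], the commutator returns a
    multiple of the string that is one step shorter. *)
Lemma wdot_iter_lower_self k r F : at_depth k F -> raise F = zero2 R ->
  wdot (iter r lower F) (iter r lower F) =
    [[r]] * qfall q ((n1 + n2)%:R - 2 * k%:R) r * wdot F F.
Proof.
move=> Fk F0; elim: r => [|r IH]; first by rewrite qfact0 qfall0 !mul1r.
rewrite [X in wdot _ X]iterS wdot_lower.
have -> : raise (iter r.+1 lower F) = fun a p =>
    qnum q r.+1%:R * qnum q ((n1 + n2)%:R - 2 * k%:R - r%:R) * iter r lower F a p.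
  apply/funext => a; apply/funext => p.
  by rewrite (raise_iter_lower q_gt0 q_lt1 n1 n2 r a p Fk) F0 iter_lower_zero2 /zero2 add0r.
rewrite qfactS qfallSr.
transitivity (qnum q r.+1%:R * qnum q ((n1 + n2)%:R - 2 * k%:R - r%:R) *
    wdot (iter r lower F) (iter r lower F)); last by rewrite IH; ring.
rewrite /wdot mulr_sumr; apply: eq_bigr => a _; rewrite mulr_sumr; apply: eq_bigr => p _.
by ring.
Qed.

(** * The highest-weight vector, its descendants and their norms *)

Section HighestVector.
Variable k : nat.
Hypotheses (k_le1 : (k <= n1)%N) (k_le2 : (k <= n2)%N).

(** Restricting [cg_poly] to one depth makes it a weight vector, of weight j1 + j2 - t. *)
Definition cg_slice (t a p : nat) : R :=
  if (a + p)%N == t then cg_poly q n1 n2 k a p else 0.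

Lemma cg_slice_at_depth t : at_depth t (cg_slice t).
Proof. by move=> a p /negPf; rewrite /cg_slice => ->. Qed.

Lemma lower_cg_slice t : (k <= t)%N -> lower (cg_slice t) = cg_slice t.+1.
Proof.
move=> kt; apply/funext => a; apply/funext => p.
have [E|] := eqVneq (a + p)%N t.+1; last first.
  move=> apt; rewrite (lower_at_depth q (@cg_slice_at_depth t) apt).
  by rewrite /cg_slice (negPf apt).
rewrite /cg_slice E eqxx cg_poly_lower ?E // /lower.
congr (_ + _).
  case: a E => [|a] /= E; first by rewrite qnum0 !(mulr0, mul0r).
  by move: E; rewrite addSn => -[->]; rewrite eqxx.
case: p E => [|p] /= E; first by rewrite qnum0 !(mulr0, mul0r).
by move: E; rewrite addnS => -[->]; rewrite eqxx.
Qed.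

Lemma iter_lower_cg_slice n : iter n lower (cg_slice k) = cg_slice (k + n).
Proof.
by elim: n => [|n IH]; rewrite ?addn0 // iterS IH lower_cg_slice ?leq_addr // addnS.
Qed.

(** In the product form of [cg_poly_highest] the two terms of [raise] differ only in sign, once the
    powers of q are collected. *)
Lemma raise_cg_slice : raise (cg_slice k) = zero2 R.
Proof.
apply/funext => a; apply/funext => p; rewrite /zero2 /raise /cg_slice addSn addnS.
case: eqP => [E|_]; last by rewrite !mulr0 addr0.
rewrite !(cg_poly_highest q_gt0 q_lt1 k_le1 k_le2) ?addSn ?addnS //.
have an : (a < n1)%N by lia.
have pn : (p < n2)%N by lia.
rewrite -(natrB _ (ltnW an)) -(natrB _ (ltnW pn)).
have -> : p.+1%:R * (n1 + n2 - k).+1%:R = p%:R * (n1 + n2 - k).+1%:R + (n1 + n2 - k).+1%:R :> R.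
  by rewrite -[in LHS]natr1; ring.
rewrite (qpowD q_gt0 (_ * _)).
have -> : q `^ (n2 - p)%:R = q `^ (a%:R - n1%:R) * q `^ (n1 + n2 - k).+1%:R.
  rewrite -qpowD //; congr powR.
  have -> : (n1 + n2 - k).+1%:R = n1%:R + (n2 - (p + a))%:R :> R by rewrite -natrD; congr (_%:R); lia.
  by rewrite !natrB ?natrD; [ring | lia..].
rewrite -(subnSK an) -(subnSK pn) !qfactS exprS.
by ring.
Qed.

Lemma cg_slice_top : cg_slice k 0 k =
  (-1) ^+ k * q `^ (k%:R * (n1 + n2 - k).+1%:R) * ([[n2 - k]] * [[n1]])
    / ([[(n1 + n2 - k).+1]] * [[n1 - k]]).
Proof. by rewrite /cg_slice eqxx (cg_poly_highest q_gt0 q_lt1) // subn0. Qed.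

Lemma cg_slice_top_neq0 : cg_slice k 0 k != 0.
Proof.
by rewrite cg_slice_top !mulf_neq0 ?invr_eq0 ?mulf_neq0 ?signr_eq0 ?p0 ?f0.
Qed.

(* In depth k, [raise W = 0] is a two-term recursion along a + p = k. *)
Lemma highest_vector_unique W : at_depth k W -> raise W = zero2 R ->
  W = fun a p => W 0 k / cg_slice k 0 k * cg_slice k a p.
Proof.
move=> Wk W0.
have step F a p : raise F = zero2 R -> (a + p.+1)%N = k ->
    F a.+1 p = - (q `^ (a%:R - n1%:R) * qnum q (n2%:R - p%:R) /
      (q `^ (n2%:R - p%:R) * qnum q (n1%:R - a%:R))) * F a p.+1.
  move=> F0 E; have := congr1 (fun f => f a p) F0; rewrite /raise /zero2 => /eqP.
  have h : qnum q (n1%:R - a%:R) != 0.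
    by rewrite gt_eqF // qnum_gt0 // subr_gt0 ltr_nat; lia.
  rewrite addr_eq0 => /eqP H.
  rewrite -[LHS](mulKf (mulf_neq0 (p0 (n2%:R - p%:R)) h)) H.
  by field; rewrite p0 h.
apply/funext => a; apply/funext => p.
have [apk|apk] := eqVneq (a + p)%N k; last by rewrite Wk // /cg_slice (negPf apk) mulr0.
elim: a p apk => [|a IH] p.
  by rewrite add0n => ->; rewrite divfK // cg_slice_top_neq0.
rewrite addSnnS => apk.
rewrite (step W) // IH // (step (cg_slice k)) ?raise_cg_slice //.
by ring.
Qed.

(** The q-factorials of the weight that depend on n1 and n2 cancel one of the two copies in the
    squared product form; what remains is [sum_qbin_diagonal] with x = n2 - k and y = n1 - k. *)
Lemma wdot_cg_slice_highest : wdot (cg_slice k) (cg_slice k) =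
  q `^ (k%:R * (n1 + n2 - k).+1%:R) * [[n2 - k]]
   / ([[(n1 + n2 - k).+1]] * [[n1 - k]] * [[(n1 + n2 - 2 * k).+1]] * [[k]]).
Proof.
rewrite /wdot.
transitivity (\sum_(p < k.+1) depth_weight (k - p) p * cg_poly q n1 n2 k (k - p) p ^+ 2).
  rewrite exchange_big /=.
  rewrite (big_ord_widen n2.+1 (fun p => depth_weight (k - p) p * cg_poly q n1 n2 k (k - p) p ^+ 2)) ?ltnS //.
  rewrite [RHS]big_mkcond /=; apply: eq_bigr => p _.
  case: ifP => pk.
    have ltn : (k - p < n1.+1)%N by lia.
    rewrite (bigD1 (Ordinal ltn)) //= big1 ?addr0 => [|i].
      by rewrite /cg_slice subnK ?eqxx //; ring.
    rewrite -val_eqE /= /cg_slice => ik.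
    by case: eqP => [|_]; [lia | rewrite mulr0].
  rewrite big1 // => i _; rewrite /cg_slice.
  by case: eqP => [|_]; [lia | rewrite mulr0].
transitivity (q `^ (n2%:R * k%:R) / ([[(n1 + n2 - k).+1]] * [[n1 - k]]) ^+ 2 *
  \sum_(p < k.+1) q `^ (p%:R * ((n2 - k)%:R + (n1 - k)%:R + 2))
     * ([[n1 - k + p]] * [[n2 - k + (k - p)]] / ([[p]] * [[k - p]]))).
  rewrite mulr_sumr; apply: eq_bigr => p _.
  have pk : (p <= k)%N by rewrite -ltnS.
  rewrite (cg_poly_highest q_gt0 q_lt1) ?subnK // /depth_weight.
  have -> : (n1 - (k - p) = n1 - k + p)%N by lia.
  have -> : (n2 - k + (k - p) = n2 - p)%N by lia.
  have -> : n2%:R * (k - p)%:R - n1%:R * p%:R = n2%:R * k%:R - (n1 + n2)%:R * p%:R :> R.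
    by rewrite natrB // natrD; ring.
  have -> : p%:R * ((n2 - k)%:R + (n1 - k)%:R + 2) =
     p%:R * (n1 + n2 - k).+1%:R + p%:R * (n1 + n2 - k).+1%:R - (n1 + n2)%:R * p%:R :> R.
    by rewrite -[(n1 + n2 - k).+1%:R]natr1 !natrB ?natrD ?(leq_trans k_le1 (leq_addr n2 n1)) //; ring.
  rewrite !(qpowB q_gt0) !(qpowD q_gt0).
  (* The sign is named so that its square can be isolated and replaced by 1. *)
  set u := (-1) ^+ p; have u2 : u * u = 1 by rewrite -expr2 sqrr_sign.
  transitivity (u * u * (q `^ (n2%:R * k%:R) / ([[(n1 + n2 - k).+1]] * [[n1 - k]]) ^+ 2 *
     (q `^ (p%:R * (n1 + n2 - k).+1%:R) * q `^ (p%:R * (n1 + n2 - k).+1%:R) /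
     q `^ ((n1 + n2)%:R * p%:R) * ([[n1 - k + p]] * [[n2 - p]] / ([[p]] * [[k - p]]))))).
    by field; rewrite !f0 !p0.
  by rewrite u2 mul1r.
rewrite (sum_qbin_diagonal q_gt0 q_lt1).
have -> : (n2 - k + (n1 - k) + k = n1 + n2 - k)%N by lia.
have -> : (n2 - k + (n1 - k) = n1 + n2 - 2 * k)%N by lia.
have -> : k%:R * (n1 + n2 - k).+1%:R = n2%:R * k%:R + k%:R * ((n1 - k)%:R + 1) :> R.
  by rewrite -[(n1 + n2 - k).+1%:R]natr1 !natrB ?natrD ?(leq_trans k_le1 (leq_addr n2 n1)) //; ring.
by rewrite qpowD //; field; rewrite !f0.
Qed.

Lemma wdot_cg_slice_gt0 : 0 < wdot (cg_slice k) (cg_slice k).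
Proof.
by rewrite wdot_cg_slice_highest divr_gt0 // !mulr_gt0 ?qpow_gt0 ?qfact_gt0.
Qed.

Lemma wdot_cg_slice n j2 : (j2 + 2 * k = n1 + n2)%N -> (n <= j2)%N ->
  wdot (cg_slice (k + n)) (cg_slice (k + n)) =
    [[n]] * [[j2]] / [[j2 - n]] * wdot (cg_slice k) (cg_slice k).
Proof.
move=> jk nj.
rewrite -iter_lower_cg_slice (wdot_iter_lower_self _ (@cg_slice_at_depth k) raise_cg_slice).
have -> : (n1 + n2)%:R - 2 * k%:R = j2%:R :> R by rewrite -jk natrD natrM; ring.
by rewrite -(qfall_nat q nj); field; rewrite f0.
Qed.

End HighestVector.
End WeightedProduct.

(** * Transfer to the matrices on D^j1 and D^j2 *)

Section OneSpin.
Variables (R : realType) (q : R) (N : nat).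
Let j : R := N%:R / 2.

Lemma dimD_half : dimD j = N.+1.
Proof. by rewrite /dimD /j mulrC divfK ?pnatr_eq0 // natrK. Qed.

Lemma ket_half (x : R) (n : nat) (i : 'I_(dimD j)) :
  x = - j + n%:R -> ket j x i 0 = (i == n :> nat)%:R.
Proof. by move=> ->; rewrite mxE /weight (inj_eq (addrI _)) eqr_nat. Qed.

Lemma ket_half0 (x : R) (i : 'I_(dimD j)) : x < - j -> ket j x i 0 = 0.
Proof.
move=> xj; rewrite mxE /weight; case: eqP => // E.
by move: xj; rewrite -E gtrDl ltrn0.
Qed.

Lemma ord_dimD_le (i : 'I_(dimD j)) : (i <= N)%N.
Proof. by rewrite -ltnS -dimD_half. Qed.

Lemma ltn_dimD_half n : (n < dimD j)%N = (n <= N)%N.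
Proof. by rewrite dimD_half. Qed.

(** Index i stands for m = -j + i, hence for depth N - i. The row of depth 0 is zero, in agreement
    with the factor [[0]] on the right. *)
Lemma Jminus_depth (phi : nat -> R[i]) (i : 'I_(dimD j)) :
  let a := (N - i)%N in
  \sum_k Jminus q j i k * phi (N - k)%N =
  (Num.sqrt (qnum q a%:R * qnum q (N%:R - a%:R + 1)))%:C * phi a.-1.
Proof.
move=> a; have iN := ord_dimD_le i.
have entry (k : 'I_(dimD j)) : Jminus q j i k =
    (Num.sqrt (qnum q k%:R * qnum q (N%:R - k%:R + 1)))%:C * (i.+1 == k)%:R.
  rewrite mxE /=.
  have -> : j + weight k = k%:R by rewrite /weight; ring.
  have -> : j - weight k + 1 = N%:R - k%:R + 1 by rewrite /weight /j; field.
  congr (_ * _).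
  case: k => -[|k] kN /=.
    by rewrite ket_half0 // /weight /= addr0 gtrDl ltrN10.
  by rewrite (@ket_half _ k) // /weight /= -natr1; ring.
have [E|iN'] := eqVneq (nat_of_ord i) N.
  rewrite big1 => [|k _]; first by rewrite /a E subnn qnum0 mul0r sqrtr0 mul0r.
  rewrite entry E; have := ord_dimD_le k; case: eqP => [<-|_ _]; first by rewrite ltnn.
  by rewrite mulr0 mul0r.
have h : (i.+1 < dimD j)%N by rewrite ltn_dimD_half; lia.
rewrite (bigD1 (Ordinal h)) //= big1 ?addr0 => [|k].
  rewrite entry /= eqxx mulr1.
  have -> : a.-1 = (N - i.+1)%N by lia.
  have -> : a%:R = N%:R - i%:R :> R by rewrite natrB.
  have -> : N%:R - i.+1%:R + 1 = N%:R - i%:R :> R by rewrite -natr1; ring.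
  have -> : N%:R - (N%:R - i%:R) + 1 = i.+1%:R :> R by rewrite -natr1; ring.
  by rewrite (mulrC (qnum q i.+1%:R)).
by rewrite -val_eqE /= eq_sym entry => /negPf ->; rewrite mulr0 mul0r.
Qed.

Lemma Jplus_depth (phi : nat -> R[i]) (i : 'I_(dimD j)) :
  let a := (N - i)%N in
  \sum_k Jplus q j i k * phi (N - k)%N =
  (Num.sqrt (qnum q a.+1%:R * qnum q (N%:R - a%:R)))%:C * phi a.+1.
Proof.
move=> a; have iN := ord_dimD_le i.
have entry (k : 'I_(dimD j)) : Jplus q j i k =
    (Num.sqrt (qnum q (N%:R - k%:R) * qnum q k.+1%:R))%:C * (i == k.+1 :> nat)%:R.
  rewrite mxE /=.
  have -> : j - weight k = N%:R - k%:R by rewrite /weight /j; field.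
  have -> : j + weight k + 1 = k.+1%:R by rewrite /weight -natr1; ring.
  congr (_ * _).
  by rewrite (@ket_half _ k.+1) // /weight /= -natr1; ring.
have [E|i0] := eqVneq (nat_of_ord i) 0%N.
  rewrite big1 => [|k _]; first by rewrite /a E subn0 subrr qnum0 mulr0 sqrtr0 mul0r.
  by rewrite entry E mulr0 mul0r.
have h : (i.-1 < dimD j)%N by rewrite ltn_dimD_half; lia.
rewrite (bigD1 (Ordinal h)) //= big1 ?addr0 => [|k].
  rewrite entry /= prednK ?lt0n // eqxx mulr1.
  have -> : a.+1 = (N - i.-1)%N by lia.
  have -> : (N - i.-1)%:R = N%:R - i.-1%:R :> R by rewrite natrB //; lia.
  have -> : N%:R - a%:R = i%:R :> R by rewrite natrB //; ring.
  by [].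
rewrite -val_eqE /= entry => ki; case: eqP => [E|_]; last by rewrite mulr0 mul0r.
by move: ki; rewrite E eqxx.
Qed.

Lemma qJ0_depth (x : R) (phi : nat -> R[i]) (i : 'I_(dimD j)) :
  let a := (N - i)%N in
  \sum_k qJ0 q x j i k * phi (N - k)%N = (q `^ (x * (j - a%:R)))%:C * phi a.
Proof.
move=> a; have iN := ord_dimD_le i.
rewrite (bigD1 i) //= big1 ?addr0 => [|k].
  rewrite mxE /= (@ket_half _ i) // eqxx mulr1 /weight natrB //.
  by have -> : - j + i%:R = j - (N%:R - i%:R) by rewrite /j; field.
by rewrite mxE /= (@ket_half _ k) // eq_sym -val_eqE /= => /negPf ->; rewrite mulr0 mul0r.
Qed.

End OneSpin.

Lemma tensmx_mul_col (S : comPzRingType) (m n : nat) (M : 'M[S]_m) (M' : 'M[S]_n)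
    (F : 'I_m -> 'I_n -> S) (x : 'I_(m * n)) :
  ((M *t M') *m (\col_y F (mxtens_unindex y).1 (mxtens_unindex y).2)) x 0 =
  \sum_i M (mxtens_unindex x).1 i * \sum_l M' (mxtens_unindex x).2 l * F i l.
Proof.
rewrite mxE; under [RHS]eq_bigr => i _ do rewrite mulr_sumr.
rewrite pair_big (reindex (@mxtens_index m n)); last first.
  by exists (@mxtens_unindex m n) => y _; rewrite (mxtens_indexK, mxtens_unindexK).
apply: eq_bigr => -[i l] _; rewrite !mxE mxtens_indexK /=. by rewrite mulrA.
Qed.

Section TwoSpins.
Variables (R : realType) (q : R).
Hypotheses (q_gt0 : 0 < q) (q_lt1 : q < 1).
Variables (n1 n2 : nat).
Let j1 : R := n1%:R / 2.
Let j2 : R := n2%:R / 2.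

Local Notation lower := (lower q).
Local Notation raise := (raise q n1 n2).
Local Notation wt := (depth_weight q n1 n2).

Let qn_ge0 m : 0 <= qnum q m%:R. Proof. by rewrite qnum_ge0 ?ler0n. Qed.
Let qpn_ge0 x y : 0 <= y -> 0 <= q `^ x * y.
Proof. exact: mulr_ge0 (powR_ge0 _ _). Qed.

(** Because [x y w = x^2 w']. Here w, w' are neighbouring depth weights and x, y the matching
    entries of [lower] and [raise], in either order: a square-root matrix entry becomes a one-sided,
    root-free one. *)
Lemma sqrt_balance (w w' x y : R) : 0 <= x -> 0 <= y -> w' * x = w * y ->
  Num.sqrt (x * y) * Num.sqrt w = x * Num.sqrt w'.
Proof.
move=> x0 y0 E; rewrite -sqrtrM ?mulr_ge0 //.
have -> : x * y * w = x ^+ 2 * w' by rewrite -mulrA [y * w]mulrC -E; ring.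
by rewrite sqrtrM ?sqr_ge0 // sqrtr_sqr ger0_norm.
Qed.

(** The power of q contributed by the coproduct is the geometric mean of the powers occurring in
    [lower] and in [raise], which brings the entries into the form of [sqrt_balance]. *)
Lemma qpow_half (x y : R) (m : nat) : x = m%:R / 2 ->
  q `^ (x - y) = Num.sqrt (q `^ (- y) * q `^ (m%:R - y)).
Proof.
move=> ->; rewrite -qpowD //.
have -> : - y + (m%:R - y) = (m%:R / 2 - y) + (m%:R / 2 - y) by field.
by rewrite (qpowD q_gt0 (_ - _)) -expr2 sqrtr_sqr ger0_norm // powR_ge0.
Qed.

Definition depth_vec (G : nat -> nat -> R) : 'cV[R[i]]_(dimD j1 * dimD j2) :=
  \col_x let a := (n1 - (mxtens_unindex x).1)%N in
          let p := (n2 - (mxtens_unindex x).2)%N in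
          (Num.sqrt (wt a p) * G a p)%:C.

Lemma Jminus12_depth_vec G : Jminus12 q j1 j2 *m depth_vec G = depth_vec (lower G).
Proof.
pose f a p := (Num.sqrt (wt a p) * G a p)%:C.
apply/colP => x; rewrite mulmxDl mxE.
rewrite !(tensmx_mul_col _ _ (fun i l => f (n1 - i)%N (n2 - l)%N)).
have E1 : forall i, \sum_l qJ0 q 1 j2 (mxtens_unindex x).2 l * f (n1 - i)%N (n2 - l)%N =
   (q `^ (j2 - (n2 - (mxtens_unindex x).2)%:R))%:C * f (n1 - i)%N (n2 - (mxtens_unindex x).2)%N.
  by move=> i; rewrite (qJ0_depth q 1 (f (n1 - i)%N)) mul1r.
have E2 : forall i, \sum_l Jminus q j2 (mxtens_unindex x).2 l * f (n1 - i)%N (n2 - l)%N =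
   (Num.sqrt (qnum q (n2 - (mxtens_unindex x).2)%:R *
     qnum q (n2%:R - (n2 - (mxtens_unindex x).2)%:R + 1)))%:C * f (n1 - i)%N (n2 - (mxtens_unindex x).2).-1.
  by move=> i; rewrite (Jminus_depth q (f (n1 - i)%N)).
under eq_bigr => i _ do rewrite E1.
under [X in _ + X]eq_bigr => i _ do rewrite E2.
rewrite (Jminus_depth q (fun a => (q `^ (j2 - (n2 - (mxtens_unindex x).2)%:R))%:C * f a _)).
rewrite (qJ0_depth q (-1) (fun a => (_)%:C * f a _)) mxE /=.
set a := (n1 - _)%N; set p := (n2 - _)%N.
have an : (a <= n1)%N by rewrite leq_subr.
have pn : (p <= n2)%N by rewrite leq_subr.
rewrite /f -!rmorphM -rmorphD; congr (_%:C).
rewrite /lower.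
have -> : Num.sqrt (qnum q a%:R * qnum q (n1%:R - a%:R + 1)) * (q `^ (j2 - p%:R) * (Num.sqrt (wt a.-1 p) * G a.-1 p))
   = Num.sqrt (wt a p) * (q `^ (- p%:R) * qnum q a%:R * G a.-1 p).
  case: (a) an => [_|b bn] /=; first by rewrite qnum0 !(mul0r, sqrtr0, mulr0).
  have -> : n1%:R - b.+1%:R + 1 = n1%:R - b%:R :> R by rewrite -natr1; ring.
  have b1 : 0 <= qnum q (n1%:R - b%:R) by rewrite qnum_ge0 // subr_ge0 ler_nat ltnW.
  rewrite (@qpow_half _ _ n2) // [LHS]mulrA -sqrtrM ?(mulr_ge0 (qn_ge0 _)) //.
  have -> : qnum q b.+1%:R * qnum q (n1%:R - b%:R) * (q `^ (- p%:R) * q `^ (n2%:R - p%:R))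
     = (q `^ (- p%:R) * qnum q b.+1%:R) * (q `^ (n2%:R - p%:R) * qnum q (n1%:R - b%:R)) by ring.
  rewrite [LHS]mulrA (sqrt_balance _ _ (depth_weightSl q_gt0 q_lt1 _ _ bn)) ?qpn_ge0 //.
  by ring.
have -> : q `^ (-1 * (j1 - a%:R)) *
    (Num.sqrt (qnum q p%:R * qnum q (n2%:R - p%:R + 1)) * (Num.sqrt (wt a p.-1) * G a p.-1)) =
    Num.sqrt (wt a p) * (q `^ a%:R * qnum q p%:R * G a p.-1).
  have -> : -1 * (j1 - a%:R) = n1%:R / 2 - (n1%:R - a%:R) by rewrite /j1; field.
  case: (p) pn => [_|b bn] /=; first by rewrite qnum0 !(mul0r, sqrtr0, mulr0).
  have -> : n2%:R - b.+1%:R + 1 = n2%:R - b%:R :> R by rewrite -natr1; ring.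
  have b1 : 0 <= qnum q (n2%:R - b%:R) by rewrite qnum_ge0 // subr_ge0 ler_nat ltnW.
  rewrite (@qpow_half _ _ n1) // [LHS]mulrA -sqrtrM ?(qpn_ge0 _ (powR_ge0 _ _)) //.
  have -> : n1%:R - (n1%:R - a%:R) = a%:R :> R by ring.
  have -> : - (n1%:R - a%:R) = a%:R - n1%:R :> R by ring.
  have -> : q `^ (a%:R - n1%:R) * q `^ a%:R * (qnum q b.+1%:R * qnum q (n2%:R - b%:R))
     = (q `^ a%:R * qnum q b.+1%:R) * (q `^ (a%:R - n1%:R) * qnum q (n2%:R - b%:R)) by ring.
  rewrite [LHS]mulrA (sqrt_balance _ _ (depth_weightSr q_gt0 q_lt1 _ _ bn)) ?qpn_ge0 //.
  by ring.
by rewrite -mulrDr.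
Qed.

Lemma Jplus12_depth_vec G : Jplus12 q j1 j2 *m depth_vec G = depth_vec (raise G).
Proof.
pose f a p := (Num.sqrt (wt a p) * G a p)%:C.
apply/colP => x; rewrite mulmxDl mxE.
rewrite !(tensmx_mul_col _ _ (fun i l => f (n1 - i)%N (n2 - l)%N)).
have E1 : forall i, \sum_l qJ0 q 1 j2 (mxtens_unindex x).2 l * f (n1 - i)%N (n2 - l)%N =
   (q `^ (j2 - (n2 - (mxtens_unindex x).2)%:R))%:C * f (n1 - i)%N (n2 - (mxtens_unindex x).2)%N.
  by move=> i; rewrite (qJ0_depth q 1 (f (n1 - i)%N)) mul1r.
have E2 : forall i, \sum_l Jplus q j2 (mxtens_unindex x).2 l * f (n1 - i)%N (n2 - l)%N =
   (Num.sqrt (qnum q (n2 - (mxtens_unindex x).2).+1%:R *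
     qnum q (n2%:R - (n2 - (mxtens_unindex x).2)%:R)))%:C * f (n1 - i)%N (n2 - (mxtens_unindex x).2).+1.
  by move=> i; rewrite (Jplus_depth q (f (n1 - i)%N)).
under eq_bigr => i _ do rewrite E1.
under [X in _ + X]eq_bigr => i _ do rewrite E2.
rewrite (Jplus_depth q (fun a => (q `^ (j2 - (n2 - (mxtens_unindex x).2)%:R))%:C * f a _)).
rewrite (qJ0_depth q (-1) (fun a => (_)%:C * f a _)) mxE /=.
set a := (n1 - _)%N; set p := (n2 - _)%N.
have an : (a <= n1)%N by rewrite leq_subr.
have pn : (p <= n2)%N by rewrite leq_subr.
rewrite /f -!rmorphM -rmorphD; congr (_%:C).
rewrite /raise.
have a1 : 0 <= qnum q (n1%:R - a%:R) by rewrite qnum_ge0 // subr_ge0 ler_nat.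
have p1 : 0 <= qnum q (n2%:R - p%:R) by rewrite qnum_ge0 // subr_ge0 ler_nat.
have -> : Num.sqrt (qnum q a.+1%:R * qnum q (n1%:R - a%:R)) * (q `^ (j2 - p%:R) * (Num.sqrt (wt a.+1 p) * G a.+1 p))
   = Num.sqrt (wt a p) * (q `^ (n2%:R - p%:R) * qnum q (n1%:R - a%:R) * G a.+1 p).
  move: (a) an a1 => b; rewrite leq_eqVlt => /predU1P[->|bn] a1.
    by rewrite subrr qnum0 !(mul0r, sqrtr0, mulr0).
  rewrite (@qpow_half _ _ n2) // [LHS]mulrA -sqrtrM ?(mulr_ge0 (qn_ge0 _)) //.
  have -> : qnum q b.+1%:R * qnum q (n1%:R - b%:R) * (q `^ (- p%:R) * q `^ (n2%:R - p%:R))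
     = (q `^ (n2%:R - p%:R) * qnum q (n1%:R - b%:R)) * (q `^ (- p%:R) * qnum q b.+1%:R) by ring.
  rewrite [LHS]mulrA (sqrt_balance _ _ (esym (depth_weightSl q_gt0 q_lt1 _ _ bn))) ?qpn_ge0 //.
  by ring.
have -> : q `^ (-1 * (j1 - a%:R)) *
    (Num.sqrt (qnum q p.+1%:R * qnum q (n2%:R - p%:R)) * (Num.sqrt (wt a p.+1) * G a p.+1)) =
    Num.sqrt (wt a p) * (q `^ (a%:R - n1%:R) * qnum q (n2%:R - p%:R) * G a p.+1).
  have -> : -1 * (j1 - a%:R) = n1%:R / 2 - (n1%:R - a%:R) by rewrite /j1; field.
  move: (p) pn p1 => b; rewrite leq_eqVlt => /predU1P[->|bn] p1.
    by rewrite subrr qnum0 !(mul0r, sqrtr0, mulr0).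
  rewrite (@qpow_half _ _ n1) // [LHS]mulrA -sqrtrM ?(qpn_ge0 _ (powR_ge0 _ _)) //.
  have -> : n1%:R - (n1%:R - a%:R) = a%:R :> R by ring.
  have -> : - (n1%:R - a%:R) = a%:R - n1%:R :> R by ring.
  have -> : q `^ (a%:R - n1%:R) * q `^ a%:R * (qnum q b.+1%:R * qnum q (n2%:R - b%:R))
     = (q `^ (a%:R - n1%:R) * qnum q (n2%:R - b%:R)) * (q `^ a%:R * qnum q b.+1%:R) by ring.
  rewrite [LHS]mulrA (sqrt_balance _ _ (esym (depth_weightSr q_gt0 q_lt1 _ _ bn))) ?qpn_ge0 //.
  by ring.
by rewrite -mulrDr.
Qed.

End TwoSpins.

(** * The coefficient as an entry of a normalised descendant *)

Section ClebschGordan.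
Variables (R : realType) (q : R).
Hypotheses (q_gt0 : 0 < q) (q_lt1 : q < 1).
Variables (n1 n2 : nat).
Let j1 : R := n1%:R / 2.
Let j2 : R := n2%:R / 2.

Local Notation "[[ n ]]" := (qfact q n) (format "[[ n ]]").
Local Notation lower := (lower q).
Local Notation raise := (raise q n1 n2).
Local Notation wt := (depth_weight q n1 n2).
Local Notation wdot := (wdot q n1 n2).
Local Notation depth_vec := (depth_vec q n1 n2).
Let f0 := qfact_neq0 q_gt0 q_lt1.

Lemma Jminus12_pow_depth_vec n G :
  Jminus12 q j1 j2 ^+ n *m depth_vec G = depth_vec (iter n lower G).
Proof.
elim: n => [|n IH]; first by rewrite expr0 mul1mx.
by rewrite exprS -mulmxE -mulmxA IH Jminus12_depth_vec.
Qed.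

Lemma Jplus12_pow_depth_vec n G :
  Jplus12 q j1 j2 ^+ n *m depth_vec G = depth_vec (iter n raise G).
Proof.
elim: n => [|n IH]; first by rewrite expr0 mul1mx.
by rewrite exprS -mulmxE -mulmxA IH Jplus12_depth_vec.
Qed.

Lemma depth_vecZ c G : depth_vec (fun a p => c * G a p) = c%:C *: depth_vec G.
Proof. by apply/colP => x; rewrite !mxE -rmorphM /=; congr (_%:C); ring. Qed.

Lemma depth_vec_sum D (c : nat -> R) (G : nat -> nat -> nat -> R) :
  depth_vec (fun a p => \sum_(r < D) c r * G r a p) =
  \sum_(r < D) (c r)%:C *: depth_vec (G r).
Proof.
apply/colP => x; rewrite summxE mxE /= mulr_sumr rmorph_sum /=.
by apply: eq_bigr => r _; rewrite !mxE /= -rmorphM /=; congr (_%:C); ring.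
Qed.

Lemma iter_lowerZ n (c : R) G :
  iter n lower (fun a p => c * G a p) = fun a p => c * iter n lower G a p.
Proof.
elim: n => // n IH; rewrite iterS IH; apply/funext => a; apply/funext => p.
by rewrite [iter n.+1 _ _]iterS /lower; ring.
Qed.

Lemma sum_dimD_depth (V : nmodType) (N : nat) (h : nat -> V) :
  \sum_(i < dimD (N%:R / 2 : R)) h (N - i)%N = \sum_(a < N.+1) h a.
Proof.
rewrite -(big_mkord xpredT (fun i => h (N - i)%N)) dimD_half big_nat_rev big_mkord.
apply: eq_bigr => a _; congr h; have := ltn_ord a; lia.
Qed.

Lemma inner_depth_vec F G : inner (depth_vec F) (depth_vec G) = (wdot F G)%:C.
Proof.
pose f (a p : nat) : R[i] := (wt a p * F a p * G a p)%:C.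
transitivity (\sum_(i < dimD j1) \sum_(l < dimD j2) f (n1 - i)%N (n2 - l)%N).
  rewrite /inner pair_big (reindex (@mxtens_index _ _)); last first.
    by exists (@mxtens_unindex _ _) => y _; rewrite (mxtens_indexK, mxtens_unindexK).
  apply: eq_bigr => -[i l] _; rewrite !mxE mxtens_indexK /f /= [Num.conj _]conjc_real -rmorphM.
  congr (_%:C); rewrite mulrACA -expr2 sqr_sqrtr ?mulrA //.
  exact/ltW/depth_weight_gt0.
rewrite (sum_dimD_depth n1 (fun a => \sum_(l < dimD j2) f a (n2 - l)%N)).
rewrite /wdot rmorph_sum; apply: eq_bigr => a _.
by rewrite (sum_dimD_depth n2 (f a)) rmorph_sum.
Qed.

Lemma hnorm_depth_vec F : hnorm (depth_vec F) = (Num.sqrt (wdot F F))%:C.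
Proof.
have w0 : 0 <= wdot F F.
  apply: sumr_ge0 => a _; apply: sumr_ge0 => p _; rewrite -mulrA -expr2.
  by rewrite mulr_ge0 ?sqr_ge0 // ltW // depth_weight_gt0.
rewrite /hnorm inner_depth_vec -{1}(sqr_sqrtr w0) rmorphXn sqrCK //.
by rewrite ler0c sqrtr_ge0.
Qed.

Lemma ket12_depth a p (x : 'I_(dimD j1 * dimD j2)) : (a <= n1)%N -> (p <= n2)%N ->
  ket12 j1 (j1 - a%:R) j2 (j2 - p%:R) x 0 =
  (((n1 - (mxtens_unindex x).1)%N == a) && ((n2 - (mxtens_unindex x).2)%N == p))%:R.
Proof.
move=> an pn; rewrite /ket12 mxE.
have E (N b : nat) (i : 'I_(dimD (N%:R / 2 : R))) z : (b <= N)%N ->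
    ket (N%:R / 2) (N%:R / 2 - b%:R) i z = ((N - i)%N == b)%:R :> R[i].
  move=> bN; rewrite (ord1 z) (@ket_half _ _ _ (N - b)).
    by have := ord_dimD_le i => iN; congr (nat_of_bool _)%:R; apply/eqP/eqP; lia.
  by rewrite natrB //; field.
by rewrite !E // -natrM mulnb.
Qed.

Lemma inner_ket12 a p G : (a <= n1)%N -> (p <= n2)%N ->
  inner (ket12 j1 (j1 - a%:R) j2 (j2 - p%:R)) (depth_vec G) =
  (Num.sqrt (wt a p) * G a p)%:C.
Proof.
move=> an pn.
have a1 : (n1 - a < dimD j1)%N by rewrite ltn_dimD_half leq_subr.
have p1 : (n2 - p < dimD j2)%N by rewrite ltn_dimD_half leq_subr.
rewrite /inner (bigD1 (mxtens_index (Ordinal a1, Ordinal p1))) //= big1 ?addr0 => [|x xn].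
  rewrite ket12_depth // mxE mxtens_indexK /= !subKn // !eqxx /=.
  by rewrite [Num.conj _]conjc1 mul1r.
rewrite ket12_depth //; case: andP => [ [/eqP E1 /eqP E2]|_].
  case/eqP: xn; rewrite -(mxtens_unindexK x); congr mxtens_index.
  rewrite [LHS]surjective_pairing; congr (_, _); apply: val_inj => /=.
    by rewrite -E1 subKn // (ord_dimD_le (mxtens_unindex x).1).
  by rewrite -E2 subKn // (ord_dimD_le (mxtens_unindex x).2).
by rewrite [Num.conj _]conjc0 mul0r.
Qed.

Definition delta2 (a p b s : nat) : R := ((b == a) && (s == p))%:R.

Lemma depth_vec_delta2 a p : (a <= n1)%N -> (p <= n2)%N ->
  depth_vec (delta2 a p) = (Num.sqrt (wt a p))%:C *: ket12 j1 (j1 - a%:R) j2 (j2 - p%:R).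
Proof.
move=> an pn; apply/colP => x; rewrite mxE [RHS]mxE ket12_depth // /delta2.
case: andP => [ [/eqP -> /eqP ->]|_]; first by rewrite !mulr1.
by rewrite !mulr0.
Qed.

Section Coupling.
Variables (k n : nat).
Let J := (n1 + n2 - 2 * k)%N.
Let j : R := j1 + j2 - k%:R.
Hypotheses (k_le1 : (k <= n1)%N) (k_le2 : (k <= n2)%N) (n_le : (n <= J)%N).
Local Notation slice := (cg_slice q n1 n2 k).

Lemma double_j : 2 * j = J%:R.
Proof. by rewrite /j /J natrB ?natrD ?natrM; [rewrite /j1 /j2; field | lia]. Qed.

Let s := Num.sqrt (qfactr q (j + (j - n%:R)) / (qfactr q (2 * j) * qfactr q (j - (j - n%:R)))).

Lemma scale_gt0 : 0 < s.
Proof. by rewrite sqrtr_gt0 divr_gt0 ?mulr_gt0 // qfact_gt0. Qed.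

Let D := (dimD j1 * dimD j2)%N.
(** The sum of the projector at m = j, applied to the starting vector up to a scalar:
    [|j1 j1>|j2 j-j1>] sits at a = 0, p = k because j - j1 = j2 - k. *)
Let W := extremal q n1 n2 J D (delta2 0 k).
Let alpha := W 0%N k / slice k 0%N k.

(** Ensures that the cutoff of the projector sum loses nothing: k + 1 raisings kill every vector of
    depth k. *)
Lemma depth_lt_dim : (k < D)%N.
Proof.
rewrite /D !dimD_half mulSn; apply: leq_trans (leq_addr _ _).
by rewrite ltnS.
Qed.

Lemma delta2_at_depth : at_depth k (delta2 0 k).
Proof. by move=> a p apk; rewrite /delta2; case: andP => // -[/eqP a0 /eqP pk]; case/eqP: apk; rewrite a0 pk. Qed.

Lemma extremal_delta2 : W = fun a p => alpha * slice k a p.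
Proof.
apply: (highest_vector_unique q_gt0 q_lt1 k_le1 k_le2).
  by apply: extremal_at_depth; apply: delta2_at_depth.
apply/funext => a; apply/funext => p.
by apply: (raise_extremal q_gt0 q_lt1 _ _ _ depth_lt_dim delta2_at_depth); rewrite /J; lia.
Qed.

(** Pair [slice k] with W in two ways: W is [alpha] times the slice, and by adjointness the
    projector drops out, leaving the pairing with a single basis vector. *)
Lemma alpha_norm : alpha * wdot (slice k) (slice k) = wt 0 k * slice k 0%N k.
Proof.
have <- : wdot (slice k) (delta2 0 k) = wt 0 k * slice k 0%N k.
  rewrite /wdot big_ord_recl [X in _ + X]big1 => [|a _]; last first.
    by rewrite big1 // => p _; rewrite /delta2 /= mulr0.
  have h : (k < n2.+1)%N by [].
  rewrite addr0 (bigD1 (Ordinal h)) //= big1 => [|p].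
    by rewrite /delta2 !eqxx /= mulr1 addr0.
  by rewrite -val_eqE /= /delta2 eqxx /= => /negPf ->; rewrite mulr0.
have Dpos : D = D.-1.+1 by have := depth_lt_dim; lia.
rewrite -(wdot_extremal q_gt0 q_lt1 J D.-1 (delta2 0 k) (raise_cg_slice q_gt0 q_lt1 k_le1 k_le2)).
have -> : extremal q n1 n2 J D.-1.+1 (delta2 0 k) = fun a p => alpha * slice k a p.
  by rewrite -Dpos -extremal_delta2.
rewrite /wdot mulr_sumr; apply: eq_bigr => a _.
by rewrite mulr_sumr; apply: eq_bigr => p _; ring.
Qed.

(** By [alpha_norm], [alpha] has the sign of the top entry of the slice, whose product form carries
    (-1)^k. This is the phase (-1)^(j1+j2-j) of the theorem. *)
Lemma sgr_alpha : Num.sg alpha = (-1) ^+ k.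
Proof.
have h := wdot_cg_slice_gt0 q_gt0 q_lt1 k_le1 k_le2.
have -> : alpha = (-1) ^+ k * (wt 0 k * (q `^ (k%:R * (n1 + n2 - k).+1%:R) * ([[n2 - k]] * [[n1]])
    / ([[(n1 + n2 - k).+1]] * [[n1 - k]])) / wdot (slice k) (slice k)).
  apply: (mulIf (lt0r_neq0 h)); rewrite alpha_norm (cg_slice_top q_gt0 q_lt1 k_le1 k_le2).
  by field; rewrite !f0 lt0r_neq0.
rewrite sgrM sgrX sgrN sgr1 gtr0_sg ?mulr1 //.
by rewrite !(divr_gt0, mulr_gt0) ?depth_weight_gt0 ?qpow_gt0 ?qfact_gt0.
Qed.

(** [J_-^(r+n)] factors as [J_-^n J_-^r], so the operator is, up to its prefactor, n lowerings after
    the projector at m = j; they carry the highest slice to depth k + n. *)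
Lemma Pproj_ket12 : Pproj q j1 j2 j (j - n%:R) *m ket12 j1 j1 j2 (j - j1) =
  depth_vec (fun a p => s / Num.sqrt (wt 0 k) * alpha * slice (k + n) a p).
Proof.
have e0 : 0 < Num.sqrt (wt 0 k) by rewrite sqrtr_gt0 depth_weight_gt0.
have -> : ket12 j1 j1 j2 (j - j1) = (Num.sqrt (wt 0 k))^-1%:C *: depth_vec (delta2 0 k).
  rewrite depth_vec_delta2 // scalerA -rmorphM mulVf ?lt0r_neq0 // rmorph1 scale1r.
  by rewrite subr0; have -> : j - j1 = j2 - k%:R by rewrite /j; ring.
rewrite /Pproj -/s -scalemxAl -scalemxAr.
have -> : Num.truncn (j - (j - n%:R)) = n by rewrite opprB addrC subrK natrK.
rewrite (_ : \sum_(r < D) _ = Jminus12 q j1 j2 ^+ n *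
   \sum_(r < D) (extremal_coef q J r)%:C *: (Jminus12 q j1 j2 ^+ r * Jplus12 q j1 j2 ^+ r)); last first.
  rewrite mulr_sumr; apply: eq_bigr => r _.
  rewrite -mulmxE -scalemxAr mulmxE mulrA -exprD [(r + n)%N]addnC.
  congr (_%:C *: _); rewrite /extremal_coef double_j.
  by rewrite -natrD !natr1 !qfactr_nat.
rewrite -mulmxE -mulmxA mulmx_suml.
have -> : \sum_(r < D) (extremal_coef q J r)%:C *: (Jminus12 q j1 j2 ^+ r * Jplus12 q j1 j2 ^+ r)
   *m depth_vec (delta2 0 k) = depth_vec W.
  apply: etrans (esym (depth_vec_sum D (extremal_coef q J)
    (fun r => iter r lower (iter r raise (delta2 0 k))))); apply: eq_bigr => r _.
  rewrite -scalemxAl; congr (_ *: _).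
  by rewrite -mulmxE -mulmxA [X in _ *m X]Jplus12_pow_depth_vec Jminus12_pow_depth_vec.
rewrite Jminus12_pow_depth_vec extremal_delta2 iter_lowerZ.
rewrite (iter_lower_cg_slice q_gt0 q_lt1) !depth_vecZ !scalerA -!rmorphM.
by [].
Qed.

Lemma CG_slice a p : (a <= n1)%N -> (p <= n2)%N -> (a + p = k + n)%N ->
  CG q j1 (j1 - a%:R) j2 (j2 - p%:R) j (j - n%:R) =
  ((-1) ^+ k * (Num.sqrt (wt a p) * cg_poly q n1 n2 k a p) /
    Num.sqrt (wdot (slice (k + n)) (slice (k + n))))%:C.
Proof.
move=> an pn apk; rewrite /CG /coupled Pproj_ket12 hnorm_depth_vec.
set c := _ * alpha.
have -> : wdot (fun a p => c * slice (k + n) a p) (fun a p => c * slice (k + n) a p) =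
    c ^+ 2 * wdot (slice (k + n)) (slice (k + n)).
  rewrite /wdot mulr_sumr; apply: eq_bigr => b _.
  by rewrite mulr_sumr; apply: eq_bigr => t _; ring.
rewrite sqrtrM ?sqr_ge0 // sqrtr_sqr -fmorphV -depth_vecZ inner_ket12 //.
have sc : Num.sg c = (-1) ^+ k.
  rewrite /c sgrM sgr_alpha gtr0_sg ?mul1r // divr_gt0 ?scale_gt0 // sqrtr_gt0.
  exact: depth_weight_gt0.
have c0 : c != 0 by rewrite -sgr_eq0 sc signr_eq0.
have -> : slice (k + n) a p = cg_poly q n1 n2 k a p by rewrite /cg_slice apk eqxx.
(* Normalisation cancels the modulus of c, so only its sign is left. *)
have -> : (-1) ^+ k = c / `|c| by rewrite -sc {2}[c]numEsg mulfK // normr_eq0.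
by congr (_%:C); rewrite invfM; ring.
Qed.

End Coupling.
End ClebschGordan.

(** * The terminating 3F2 *)

Section Hypergeometric.
Variables (R : realType) (q : R).
Hypotheses (q_gt0 : 0 < q) (q_lt1 : q < 1).
Local Notation "[[ n ]]" := (qfact q n) (format "[[ n ]]").
Let f0 := qfact_neq0 q_gt0 q_lt1.

Lemma qpochN_nat (n r : nat) : (r <= n)%N ->
  qpoch q (- n%:R) r = (-1) ^+ r * ([[n]] / [[n - r]]).
Proof. by move=> rn; rewrite qpochN -(qfall_nat q rn) mulfK. Qed.

(** For r <= min(p, k) every q-shifted factorial is a ratio of q-factorials up to sign, with nonzero
    denominators; three signs above and two below leave one (-1)^r. *)
Lemma qhyp32_cg_poly (n1 n2 k a p : nat) :
  (a <= n1)%N -> (p <= n2)%N -> (k <= n1)%N -> (k <= n2)%N -> (k <= a + p)%N ->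
  qhyp32 q (- k%:R) (- p%:R) (- (n1 + n2 - k).+1%:R) (- (a + p)%:R) (- n2%:R)
     (q `^ (n1 - a)%:R) =
  [[k]] * [[(n1 + n2 - k).+1]] / ([[a + p]] * [[n2]]) * cg_poly q n1 n2 k a p.
Proof.
move=> an pn kn1 kn2 kap; rewrite /qhyp32 /stops /= !opprK !natr_nat /= !opprK !natrK.
(* The third upper parameter never stops the series first, since k <= n1 + n2 - k. The sum can then
   be extended from min(p, k) to k, as [qfall] vanishes for r > p. *)
have -> : (minn p (minn (n1 + n2 - k).+1 k) = minn p k)%N by lia.
rewrite /cg_poly mulr_sumr.
rewrite (big_ord_widen k.+1 (qhyp32_term q (- k%:R) (- p%:R) (- (n1 + n2 - k).+1%:R)
  (- (a + p)%:R) (- n2%:R) (q `^ (n1 - a)%:R))) ?ltnS ?geq_minr //.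
rewrite big_mkcond /=; apply: eq_bigr => r _.
have rk : (r <= k)%N by rewrite -ltnS.
rewrite ltnS leq_min rk andbT; case: leqP => rp; last first.
  by rewrite qfall_small // !(mul0r, mulr0).
rewrite /qhyp32_term !qpochN_nat; try lia.
have -> : q `^ (n1 - a)%:R ^+ r = q `^ ((n1%:R - a%:R) * r%:R).
  by rewrite -natrB // powRrM [RHS]powR_mulrn ?powR_ge0.
rewrite -(qfall_nat q rp).
have u2 : (-1) ^+ r * (-1) ^+ r = 1 :> R by rewrite -expr2 sqrr_sign.
have u0 : (-1) ^+ r != 0 :> R by rewrite signr_eq0.
by field; rewrite u0 !f0.
Qed.

End Hypergeometric.

(** * Comparison of prefactors and passage from half-integers to natural parameters *)

Lemma sqrt_div_sqrt (R : rcfType) (x y u v z : R) :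
  0 <= x -> 0 <= u -> 0 <= z -> 0 < y -> 0 < v -> z ^+ 2 * x / y = u / v ->
  z * Num.sqrt x / Num.sqrt y = Num.sqrt u / Num.sqrt v.
Proof.
move=> x0 u0 z0 y0 v0 E; rewrite -!sqrtrV ?ltW // -[z * _]mulrC.
rewrite -{1}[z]ger0_norm // -sqrtr_sqr -!sqrtrM ?sqr_ge0 ?mulr_ge0 ?sqr_ge0 //.
by rewrite -E; congr Num.sqrt; ring.
Qed.

Lemma CG_qhyp32_nat (R : realType) (q : R) (n1 n2 k a p : nat) :
  0 < q -> q < 1 -> (a <= n1)%N -> (p <= n2)%N -> (k <= n1)%N -> (k <= n2)%N ->
  (k <= a + p)%N -> (a + p <= n1 + n2 - k)%N ->
  let j1 : R := n1%:R / 2 in let j2 := n2%:R / 2 in let j := j1 + j2 - k%:R in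
  let m1 := j1 - a%:R in let m2 := j2 - p%:R in let m := m1 + m2 in
  CG q j1 m1 j2 m2 j m =
    ((-1) ^+ Num.truncn (j1 + j2 - j) * Gamma_CG q j1 j2 j m1 m2 m
     * qhyp32 q (j - j1 - j2) (m2 - j2) (- j - j1 - j2 - 1)
                (m - j1 - j2) (- (2 * j2)) (q `^ (j1 + m1)))%:C.
Proof.
move=> q_gt0 q_lt1 an pn kn1 kn2 kap apn j1 j2 j m1 m2 m.
pose n := (a + p - k)%N; pose J := (n1 + n2 - 2 * k)%N.
have f0 := qfact_neq0 q_gt0 q_lt1.
have fp := qfact_gt0 q_gt0 q_lt1.
have n0 := qnumS_neq0 q_gt0 q_lt1.
have ks : (k <= n1 + n2)%N by lia.
have nE : n%:R = a%:R + p%:R - k%:R :> R by rewrite natrB // natrD.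
have mE : m = j - n%:R by rewrite nE /m /m1 /m2 /j; ring.
rewrite {1}mE (CG_slice q_gt0 q_lt1 kn1 kn2) //; try by rewrite /n; lia.
have -> : j1 + j2 - j = k%:R by rewrite /j; ring.
have -> : j - j1 - j2 = - k%:R by rewrite /j; ring.
have -> : m2 - j2 = - p%:R by rewrite /m2; ring.
have -> : - j - j1 - j2 - 1 = - (n1 + n2 - k).+1%:R.
  by rewrite -natr1 natrB // natrD /j /j1 /j2; field.
have -> : m - j1 - j2 = - (a + p)%:R by rewrite natrD /m /m1 /m2; ring.
have -> : - (2 * j2) = - n2%:R by rewrite /j2; field.
have -> : j1 + m1 = (n1 - a)%:R by rewrite natrB // /m1 /j1; field.
rewrite qhyp32_cg_poly // natrK /Gamma_CG.
have -> : 2 * j2 = n2%:R by rewrite /j2; field.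
have -> : j1 + j2 - m = (a + p)%:R by rewrite natrD /m /m1 /m2; ring.
have -> : 2 * j + 1 = J.+1%:R.
  by rewrite -[J.+1%:R]natr1 /J natrB ?natrD ?natrM; [rewrite /j /j1 /j2; field | lia].
have -> : j + m = (J - n)%:R.
  rewrite natrB; last by rewrite /J /n; lia.
  by rewrite nE /J natrB ?natrD ?natrM; [rewrite /m /m1 /m2 /j /j1 /j2; field | lia].
have -> : j + j1 - j2 = (n1 - k)%:R by rewrite natrB // /j /j1; field.
have -> : j1 + j2 + j + 1 = (n1 + n2 - k).+1%:R.
  by rewrite -natr1 natrB // natrD /j /j1 /j2; field.
have -> : j + j2 - j1 = (n2 - k)%:R by rewrite natrB // /j /j2; field.
have -> : j1 + j2 - j = k%:R by rewrite /j; ring.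
have -> : j1 + m1 = (n1 - a)%:R by rewrite natrB // /m1 /j1; field.
have -> : j1 - m1 = a%:R by rewrite /m1; ring.
have -> : j2 + m2 = (n2 - p)%:R by rewrite natrB // /m2 /j2; field.
have -> : j2 - m2 = p%:R by rewrite /m2; ring.
have -> : j - m = n%:R by rewrite mE; ring.
rewrite !qfactr_nat.
set e := j1 * m2 - _ - _.
(* The prefactors are compared through their squares, so only 2e matters: it is the exponent in
   [depth_weight] minus the one in the highest norm. *)
have eE : e + e = n2%:R * a%:R - n1%:R * p%:R - k%:R * (n1 + n2 - k).+1%:R.
  have sE : (n1 + n2 - k).+1%:R = n1%:R + n2%:R - k%:R + 1 :> R by rewrite -natr1 natrB // natrD.
  by rewrite /e sE /m1 /m2 /j1 /j2; field.
clearbody e.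
set A := qnum q J.+1%:R * _ * _; set B := qfact q (n1 + n2 - k).+1 * _ * _ * _ * _ * _ * _ * _.
set S := wdot q n1 n2 _ _; set w := depth_weight q n1 n2 a p.
(* [[2 j2]!] and [[j1+j2-m]!] in [Gamma_CG] cancel the denominator of [qhyp32_cg_poly]. With
   [cg_poly] and the sign removed from both sides, this is what remains. *)
have key : q `^ e * qfact q k * qfact q (n1 + n2 - k).+1 * Num.sqrt A / Num.sqrt B =
    Num.sqrt w / Num.sqrt S.
  have JE : (J + 2 * k = n1 + n2)%N by rewrite /J; lia.
  have nJ : (n <= J)%N by rewrite /n /J; lia.
  have SE := wdot_cg_slice q_gt0 q_lt1 kn1 kn2 JE nJ.
  rewrite (wdot_cg_slice_highest q_gt0 q_lt1 kn1 kn2) -/J in SE.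
  have S0 : 0 < S.
    by rewrite /S SE !(divr_gt0, mulr_gt0) ?fp ?qpow_gt0.
  have B0 : 0 < B by rewrite /B !mulr_gt0 ?fp.
  apply: sqrt_div_sqrt => //.
  - have J0 : 0 <= qnum q J.+1%:R by rewrite qnum_ge0 ?ler0n.
    exact: mulr_ge0 (mulr_ge0 J0 (ltW (fp _))) (ltW (fp _)).
  - exact/ltW/depth_weight_gt0.
  - exact: mulr_ge0 (mulr_ge0 (powR_ge0 _ _) (ltW (fp _))) (ltW (fp _)).
  have -> : (q `^ e * qfact q k * qfact q (n1 + n2 - k).+1) ^+ 2 =
      q `^ (e + e) * (qfact q k * qfact q (n1 + n2 - k).+1) ^+ 2.
    by rewrite qpowD //; ring.
  rewrite eE /S SE /w /A /B /depth_weight [qfact q J.+1]qfactS !(qpowB q_gt0).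
  by field; rewrite !f0 n0 !qpow_neq0.
congr (_%:C).
transitivity ((-1) ^+ k * cg_poly q n1 n2 k a p * (Num.sqrt w / Num.sqrt S)); first by ring.
rewrite -key; field.
by rewrite !f0 sqrtr_eq0 -ltNge /B !mulr_gt0 ?fp.
Qed.

(** If j = |j1-j2| + k', then k = min(n1, n2) - k'; the bound j <= j1 + j2 is what gives k' <=
    min(n1, n2). *)
Lemma couples_top (R : realType) (n1 n2 : nat) (j1 j2 j : R) :
  j1 = n1%:R / 2 -> j2 = n2%:R / 2 -> couples j1 j2 j ->
  exists k, [/\ (k <= n1)%N, (k <= n2)%N & j = j1 + j2 - k%:R].
Proof.
move=> -> -> [k' -> ub]; have [n12|/ltnW n21] := leqP n1 n2.
  have n12R : n1%:R <= n2%:R :> R by rewrite ler_nat.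
  rewrite ler0_norm in ub *; try lra.
  have k'n : (k' <= n1)%N by rewrite -(@ler_nat R); lra.
  by exists (n1 - k')%N; split; [lia | lia | rewrite natrB //; field].
have n21R : n2%:R <= n1%:R :> R by rewrite ler_nat.
rewrite ger0_norm in ub *; try lra.
have k'n : (k' <= n2)%N by rewrite -(@ler_nat R); lra.
by exists (n2 - k')%N; split; [lia | lia | rewrite natrB //; field].
Qed.

Lemma weight_depth (R : realType) (N : nat) (j m : R) :
  j = N%:R / 2 -> is_weight j m -> exists2 a, (a <= N)%N & m = j - a%:R.
Proof.
move=> -> [i -> ub]; have iN : (i <= N)%N by rewrite -(@ler_nat R); lra.
by exists (N - i)%N; [exact: leq_subr | rewrite natrB //; field].
Qed.

Theorem mainTheorem1 (R : realType) (q j1 j2 j m1 m2 m : R)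
  (hq0 : 0 < q) (hq1 : q < 1)
  (hj1 : is_spin j1) (hj2 : is_spin j2) (hj : couples j1 j2 j)
  (hm1 : is_weight j1 m1) (hm2 : is_weight j2 m2)
  (hm : m = m1 + m2) (hmj : - j <= m <= j) :
  CG q j1 m1 j2 m2 j m =
    ((-1) ^+ Num.truncn (j1 + j2 - j) * Gamma_CG q j1 j2 j m1 m2 m
     * qhyp32 q (j - j1 - j2) (m2 - j2) (- j - j1 - j2 - 1)
                (m - j1 - j2) (- (2 * j2)) (q `^ (j1 + m1)))%:C.
Proof.
have /natrP[n1 E1] := hj1; have /natrP[n2 E2] := hj2.
have J1 : j1 = n1%:R / 2 by rewrite -E1; field.
have J2 : j2 = n2%:R / 2 by rewrite -E2; field.
have [k [kn1 kn2 Jk]] := couples_top J1 J2 hj.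
have [a an M1] := weight_depth J1 hm1.
have [p pn M2] := weight_depth J2 hm2.
subst j m m1 m2 j1 j2; case/andP: hmj => mj1 mj2.
(* The two remaining bounds translate m <= j into k <= a + p, and -j <= m into a + p <= n1 + n2 -
   k. *)
apply: CG_qhyp32_nat => //.
  by rewrite -(@ler_nat R) natrD; lra.
by rewrite -(@ler_nat R) natrB ?natrD; [lra | lia].
Qed.
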